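(* Let $\Omega\subset\mathbb R^d$ be open, let $F\colon\Omega\to\mathbb R$ be a locally irreducible real analytic function of $(x_1,\ldots,x_d)$, and let $p=(a_1,\ldots,a_d)$ be a coordinate regular point of $Z(F)$. (1) If $F$ is locally degenerate at $p$, then there exist a neighbourhood $U$ of $p$, a real analytic function $G(x_1,\ldots,x_d)$ on $U$, and two sets of real analytic single-variable functions $\{\alpha_{1,j}(x_j)\}_{j=1}^d$ and $\{\alpha_{2,j}(x_j)\}_{j=1}^d$ (each defined for the $j$-th coordinates of points of $U$) such that $$F_{x_i}=G(x_1,\ldots,x_d)\,\alpha_{2,i}(x_i)\prod_{j\neq i}\alpha_{1,j}(x_j)\qquad\text{on } U\cap Z(F),\quad\text{for every } i=1,\ldots,d.$$ (2) Conversely, if such a factorization (with some such $U$, $G$, $\alpha_{1,j}$, $\alpha_{2,j}$) holds in a neighbourhood of the coordinate regular point $p$, then $F$ is locally degenerate at $p$.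
   Context: Notation: $F_{x_i}=\partial F/\partial x_i$ and $Z(F)=\{x\in\Omega: F(x)=0\}$. ''Locally irreducible'' means that at each point of $Z(F)$ the germ of $F$ is irreducible in the ring of germs of real analytic functions. Coordinate regular point: a point $p\in Z(F)$ such that $F_{x_i}(p)\neq0$ for every $i=1,\ldots,d$. Locally degenerate: $F$ is locally degenerate at a coordinate regular point $p=(a_1,\ldots,a_d)\in Z(F)$ if there exist open intervals $I_i\subset\mathbb R$ containing $a_i$, with $I_1\times\cdots\times I_d\subset\Omega$, and analytic isomorphisms (real analytic bijections with real analytic inverse) $f_i\colon I_i\to J$ onto a common open interval $J$ containing $0$ such that, on $I_1\times\cdots\times I_d$, $$F(x_1,\ldots,x_d)=0\iff f_1(x_1)+\cdots+f_d(x_d)=0.$$ *)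

(* Defs.v *)
From HB Require Import structures.
From mathcomp Require Import all_boot all_order all_algebra.
From mathcomp Require Import all_classical all_reals all_analysis.
Import Order.TTheory GRing.Theory Num.Theory.
Import numFieldNormedType.Exports.

Set Implicit Arguments.
Unset Strict Implicit.
Unset Printing Implicit Defensive.

Local Open Scope classical_set_scope.
Local Open Scope ring_scope.

Section OneVariable.
Variable R : realType.
Implicit Types (f : R -> R) (I J : set R).

Definition analytic1_at f (a : R) :=
  exists c : nat -> R,
    \forall x \near a, pseries c (x - a) @ \oo --> f x.

(* Functions are total; only their values near points of the set matter, and
   the sets used below are open. *)
Definition analytic1_on f I := forall a, I a -> analytic1_at f a.

(* Unbounded intervals are allowed. *)
Definition open_interval I := open I /\ is_interval I.

(* Once [f] is a bijection from [I] onto [J], the left inverse [g] coincides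
   on [J] with the inverse bijection. *)
Definition analytic_iso f I J :=
  [/\ analytic1_on f I, set_bij I J f &
      exists g : R -> R, (forall x, I x -> g (f x) = x) /\ analytic1_on g J].

End OneVariable.

Section SeveralVariables.
Variables (R : realType) (d : nat).
Implicit Types (F G : 'rV[R]_d -> R) (p x v : 'rV[R]_d) (A Omega : set 'rV[R]_d).

Definition mterm (c : ('I_d -> nat) -> R) v (m : 'I_d -> nat) : R :=
  c m * \prod_(i < d) v ord0 i ^+ m i.

(* The multi-indices all of whose entries are < N; as N grows these finite
   sets exhaust all multi-indices, so for an absolutely convergent family the
   limit of these partial sums is its (unordered) sum. *)
Definition mpseries (c : ('I_d -> nat) -> R) v : R^nat :=
  fun N => \sum_(m : {ffun 'I_d -> 'I_N}) mterm c v (fun i => m i).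

Definition mpseries_norm (c : ('I_d -> nat) -> R) v : R^nat :=
  fun N => \sum_(m : {ffun 'I_d -> 'I_N}) `|mterm c v (fun i => m i)|.

Definition analytic_at F p :=
  exists c : ('I_d -> nat) -> R,
    \forall x \near p,
      cvgn (mpseries_norm c (x - p)) /\ mpseries c (x - p) @ \oo --> F x.

Definition analytic_on F A := forall p, A p -> analytic_at F p.

Definition partial (i : 'I_d) F x : R := 'D_(delta_mx ord0 i) F x.

Definition zeros Omega F : set 'rV[R]_d := [set x | Omega x /\ F x = 0].

(* The ring of germs at [p] is handled through representatives: functions
   analytic at [p], two of them being equal as germs when they agree near
   [p]. *)
Definition germ_eq p F G := \forall x \near p, F x = G x.

Definition germ_unit p F :=
  exists2 G, analytic_at G p & germ_eq p (fun x => F x * G x) (fun=> 1).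

Definition germ_irreducible p F :=
  [/\ ~ germ_eq p F (fun=> 0),
      ~ germ_unit p F &
      forall G H : 'rV[R]_d -> R, analytic_at G p -> analytic_at H p ->
        germ_eq p F (fun x => G x * H x) -> germ_unit p G \/ germ_unit p H].

Definition locally_irreducible Omega F :=
  forall p, zeros Omega F p -> germ_irreducible p F.

Definition coordinate_regular Omega F p :=
  zeros Omega F p /\ forall i, partial i F p != 0.

Definition box (I : 'I_d -> set R) : set 'rV[R]_d :=
  [set x | forall i, I i (x ord0 i)].

Definition locally_degenerate Omega F p :=
  exists (I : 'I_d -> set R) (J : set R) (f : 'I_d -> R -> R),
    [/\ forall i, open_interval (I i) /\ I i (p ord0 i),
        box I `<=` Omega,
        open_interval J /\ J 0,
        forall i, analytic_iso (f i) (I i) J &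
        forall x, box I x ->
          (F x = 0 <-> \sum_(i < d) f i (x ord0 i) = 0)].

Definition factorizes_near Omega F p :=
  exists (U : set 'rV[R]_d) (G : 'rV[R]_d -> R) (alpha1 alpha2 : 'I_d -> R -> R),
    [/\ [/\ open U, U p & U `<=` Omega],
        analytic_on G U,
        forall j, analytic1_on (alpha1 j) [set x ord0 j | x in U],
        forall j, analytic1_on (alpha2 j) [set x ord0 j | x in U] &
        forall x, (U `&` zeros Omega F) x -> forall i : 'I_d,
          partial i F x =
          G x * alpha2 i (x ord0 i) * \prod_(j < d | j != i) alpha1 j (x ord0 j)].

End SeveralVariables.

(* Main.v *)
Require Import Defs.
From mathcomp Require Import all_boot all_order all_algebra.
From mathcomp Require Import all_classical all_reals all_analysis.
From mathcomp Require Import ring lra.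
Import Order.TTheory GRing.Theory Num.Theory.
Import numFieldNormedType.Exports.

(** Both conditions fix the direction of the gradient of [F] along its zero set:
    they say that there the partial derivatives of [F] are proportional to
    numbers [beta j (x j)], each of which depends on one coordinate only.

    If [F] vanishes exactly where [\sum_j f j (x j)] does, then on the zero set
    the gradients of the two functions are proportional, because both
    functions are constant along the curves of the zero set that move only two
    coordinates ([degenerate_parallel]).  Hence the [i]-th partial derivative
    is that of index [i0] times [f i]' divided by [f i0]', which is a
    factorization whose factor [G] is the [i0]-th partial derivative.  This
    needs partial derivatives of analytic functions of several variables to be
    analytic ([analytic_partial]) and quotients of analytic functions of one
    variable to be analytic ([analytic1_quotient]).

    Conversely, a factorization gives [beta j] as the quotient of [alpha2 j] by
    [alpha1 j] ([factorizes_parallel]).  A primitive [f j] of [beta j] that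
    vanishes at the [j]-th coordinate of [p] has an analytic local inverse [g j]
    ([analytic1_coordinate]).  In the coordinates [y j = f j (x j)] all partial
    derivatives of [F] agree at every zero of [F].  Such a zero set is locally
    the hyperplane [\sum_j y j = 0] ([flat_zero_set]): over a segment of the
    hyperplane the zero set is the graph of a function with zero derivative.
    Restricting all [y j] to one common interval gives the degeneracy.

    The one-variable facts all rest on the algebra of polynomials with the norm
    [\sum_i `|P_i| r ^ i].  A Cauchy sequence for this norm converges on the
    disc of radius [r] to the sum of a power series
    ([wnorm_cauchy_pseries]), so that quotients and local inverses can be
    obtained as fixed points of contractions on polynomials
    ([wnorm_fixpoint]), without formal computations with the coefficients. *)

Set Implicit Arguments.
Unset Strict Implicit.
Unset Printing Implicit Defensive.
Local Open Scope classical_set_scope.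
Local Open Scope ring_scope.

(** * Weighted norms of polynomials *)

Section WeightedNorm.
Variable R : realType.
Implicit Types (r x y rho : R) (P Q p q : {poly R}).

Definition abs_poly P : {poly R} := map_poly Num.norm P.

Lemma coef_abs P i : (abs_poly P)`_i = `|P`_i|.
Proof. by rewrite coef_map_id0 ?normr0. Qed.

Lemma abs_polyS P c : abs_poly (P * 'X + c%:P) = abs_poly P * 'X + `|c|%:P.
Proof.
apply/polyP => i; rewrite coef_abs !coefD !coefMX !coefC coef_abs.
by case: i => [|i] /=; rewrite ?add0r ?addr0.
Qed.

Lemma abs_poly0 : abs_poly 0 = 0.
Proof. by apply/polyP => i; rewrite coef_abs !coef0 normr0. Qed.

(** The weighted norm [\sum_i `|P_i| r ^ i], written as an evaluation so that
    inequalities between norms reduce to inequalities between coefficients. *)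
Definition wnorm r P := (abs_poly P).[r].

Lemma wnormS r P c : wnorm r (P * 'X + c%:P) = wnorm r P * r + `|c|.
Proof. by rewrite /wnorm abs_polyS !hornerE. Qed.

Lemma wnorm0 r : wnorm r 0 = 0.
Proof. by rewrite /wnorm abs_poly0 horner0. Qed.

Lemma wnormC r c : wnorm r c%:P = `|c|.
Proof. have -> : c%:P = 0 * 'X + c%:P by rewrite mul0r add0r.
by rewrite wnormS wnorm0 mul0r add0r. Qed.

Lemma le_horner r P Q : 0 <= r -> (forall i, P`_i <= Q`_i) -> P.[r] <= Q.[r].
Proof.
move=> r0 PQ; pose n := maxn (size P) (size Q).
rewrite (@horner_coef_wide _ n) ?leq_maxl// (@horner_coef_wide _ n Q) ?leq_maxr//.
by apply: ler_sum => i _; rewrite ler_wpM2r// exprn_ge0.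
Qed.

Lemma wnorm_ge0 r P : 0 <= r -> 0 <= wnorm r P.
Proof.
move=> r0; rewrite -(horner0 r); apply: le_horner => // i.
by rewrite coef0 coef_abs.
Qed.

Lemma wnormD r P Q : 0 <= r -> wnorm r (P + Q) <= wnorm r P + wnorm r Q.
Proof.
move=> r0; rewrite /wnorm -hornerD; apply: le_horner => // i.
by rewrite coefD !coef_abs coefD ler_normD.
Qed.

Lemma wnormM r P Q : 0 <= r -> wnorm r (P * Q) <= wnorm r P * wnorm r Q.
Proof.
move=> r0; rewrite /wnorm -hornerM; apply: le_horner => // i.
rewrite coef_abs !coefM; apply: le_trans (ler_norm_sum _ _ _) _.
by apply: ler_sum => j _; rewrite normrM !coef_abs.
Qed.

Lemma coef_le_wnorm r P n : 0 <= r -> `|P`_n| * r ^+ n <= wnorm r P.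
Proof.
move=> r0; have -> : `|P`_n| * r ^+ n = (`|P`_n| *: 'X^n).[r] by rewrite !hornerE.
apply: le_horner => // i; rewrite coefZ coefXn coef_abs.
by case: eqVneq => [->|_]; rewrite ?mulr1 ?mulr0.
Qed.

Lemma wnorm_comp r rho P Q : 0 <= r -> wnorm r Q <= rho ->
  wnorm r (P \Po Q) <= wnorm rho P.
Proof.
move=> r0 Qrho; have rho0 := le_trans (wnorm_ge0 Q r0) Qrho.
elim/poly_ind: P => [|p c IH]; first by rewrite comp_poly0 !wnorm0.
rewrite comp_poly_MXaddC wnormS.
apply: le_trans (wnormD _ _ r0) _; rewrite wnormC lerD2r.
by apply: le_trans (wnormM _ _ r0) _; rewrite ler_pM// wnorm_ge0.
Qed.

(** The formal derivative of [abs_poly P] dominates the derivative of [P] on the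
    whole ball of radius [rho], so its value at [rho] is a Lipschitz constant
    for the substitution of polynomials of norm at most [rho] into [P]. *)
Lemma wnorm_comp_lip r rho P Q Q' : 0 <= r -> wnorm r Q <= rho ->
  wnorm r Q' <= rho ->
  wnorm r ((P \Po Q) - (P \Po Q')) <= (abs_poly P)^`().[rho] * wnorm r (Q - Q').
Proof.
move=> r0 Qrho Q'rho; have rho0 := le_trans (wnorm_ge0 Q r0) Qrho.
elim/poly_ind: P => [|p c IH].
  by rewrite !comp_poly0 subrr wnorm0 abs_poly0 deriv0 horner0 mul0r.
rewrite !comp_poly_MXaddC abs_polyS derivD derivM derivX derivC addr0 mulr1.
rewrite !hornerE.
have -> : (p \Po Q) * Q + c%:P - ((p \Po Q') * Q' + c%:P) =
  ((p \Po Q) - (p \Po Q')) * Q + (p \Po Q') * (Q - Q') by ring.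
apply: le_trans (wnormD _ _ r0) _; rewrite [leRHS]mulrDl; apply: lerD.
  apply: le_trans (wnormM _ _ r0) _; rewrite mulrAC.
  by rewrite ler_pM ?wnorm_ge0.
apply: le_trans (wnormM _ _ r0) _; rewrite ler_wpM2r ?wnorm_ge0//.
exact: wnorm_comp.
Qed.

(** Evaluation at [x] is substitution of a constant polynomial of norm [`|x|]. *)
Lemma horner_le_wnorm r P x : `|x| <= r -> `|P.[x]| <= wnorm r P.
Proof.
move=> xr; have r0 := le_trans (normr_ge0 x) xr.
by rewrite -(wnormC r) -comp_polyCr wnorm_comp// wnormC.
Qed.

Lemma horner_lip rho P x y : `|x| <= rho -> `|y| <= rho ->
  `|P.[x] - P.[y]| <= (abs_poly P)^`().[rho] * `|x - y|.
Proof.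
move=> xr yr; have := @wnorm_comp_lip 0 rho P x%:P y%:P (lexx _).
rewrite !wnormC => /(_ xr yr).
by rewrite !comp_polyCr -!polyCB !wnormC.
Qed.

End WeightedNorm.

Section Limits.
Variable R : realType.
Implicit Types (r x y rho : R) (P Q : {poly R}) (c : nat -> R).

Definition trunc c N : {poly R} := \poly_(i < N) c i.

Lemma trunc_horner c N x : (trunc c N).[x] = pseries c x N.
Proof. by rewrite horner_poly /pseries /series/= big_mkord. Qed.

Lemma truncS c N : trunc c N.+1 = trunc c N + (c N)%:P * 'X^N.
Proof.
apply/polyP => i; rewrite coefD coefCM coefXn !coef_poly ltnS leq_eqVlt.
by case: (eqVneq i N) => [->|]/=; rewrite ?ltnn ?mulr1 ?add0r// mulr0 addr0.
Qed.

Lemma wnorm_trunc r c N : wnorm r (trunc c N) = \sum_(i < N) `|c i| * r ^+ i.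
Proof.
rewrite /wnorm (@horner_coef_wide _ N).
  by apply: eq_bigr => i _; rewrite coef_abs coef_poly ltn_ord.
apply: leq_trans (size_poly _ _) _; exact: size_poly.
Qed.

Lemma wnorm_monom r (a : R) N : 0 <= r -> wnorm r (a%:P * 'X^N) = `|a| * r ^+ N.
Proof.
move=> r0; rewrite /wnorm.
have -> : abs_poly (a%:P * 'X^N) = `|a|%:P * 'X^N.
  apply/polyP => i; rewrite coef_abs !coefCM coefXn normrM.
  by congr (_ * _); case: eqP => _; rewrite ?normr1 ?normr0.
by rewrite !hornerE.
Qed.

(** Completeness of the weighted l1 space.  Each coefficient converges, and the
    tail bound passes to the limit on every finite set of coefficients; since
    it does not depend on that set, the limit series is close to [h k] in norm,
    hence close to its values uniformly on the disc. *)
Lemma wnorm_cauchy_pseries r (h : nat -> {poly R}) (eps : nat -> R) : 0 < r ->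
  (forall k l, (k <= l)%N -> wnorm r (h l - h k) <= eps k) ->
  eps @ \oo --> 0 ->
  exists c (u : R -> R), forall x, `|x| <= r ->
    (fun k => (h k).[x]) @ \oo --> u x /\ pseries c x @ \oo --> u x.
Proof.
move=> r0 hC e0; have r0' := ltW r0.
have cauch (v : nat -> R) (K : R) : 0 < K ->
    (forall k l, (k <= l)%N -> `|v l - v k| * K <= eps k) -> cvgn v.
  move=> K0 vC; apply/cauchy_cvgP/cauchy_exP => e ep.
  have : \forall k \near \oo, `|0 - eps k| < e * K.
    by move/cvgrPdist_lt : e0; apply; rewrite mulr_gt0.
  case=> n _ /(_ n (leqnn n)) en; exists (v n); exists n => // l /= nl.
  rewrite -ball_normE /= distrC -(ltr_pM2r K0); apply: le_lt_trans (vC _ _ nl) _.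
  by apply: le_lt_trans (ler_norm _) _; move: en; rewrite sub0r normrN.
have cC n : cvgn (fun k => (h k)`_n).
  apply: (cauch _ (r ^+ n)); first by rewrite exprn_gt0.
  move=> k l kl; apply: le_trans (hC _ _ kl).
  by rewrite -coefB coef_le_wnorm.
have cH x : `|x| <= r -> cvgn (fun k => (h k).[x]).
  move=> xr; apply: (cauch _ 1) => // k l kl; rewrite mulr1.
  by apply: le_trans (hC _ _ kl); rewrite -hornerN -hornerD horner_le_wnorm.
exists (fun n => limn (fun k => (h k)`_n)), (fun x => limn (fun k => (h k).[x])).
set c := fun n => _.
move=> x xr; split; first exact: cH.
(* The limit of the Cauchy estimate, restricted to the first [N] coefficients. *)
have tail k N : \sum_(n < N) `|c n - (h k)`_n| * r ^+ n <= eps k.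
  have : (\sum_(n < N) `|(h l)`_n - (h k)`_n| * r ^+ n) @[l --> \oo] -->
         \sum_(n < N) `|c n - (h k)`_n| * r ^+ n.
    apply: (cvg_big add_continuous) => n _; apply: cvgMr_tmp; apply: cvg_norm.
    apply: cvgB; [exact: cC|exact: cvg_cst].
  move=> /cvgr_to_le; apply; exists k => // l /= kl.
  apply: le_trans (hC _ _ kl); rewrite /wnorm.
  rewrite (@horner_coef_wide _ (maxn N (size (abs_poly (h l - h k)))));
    last by rewrite leq_maxr.
  rewrite (big_ord_widen _ (fun n => `|(h l)`_n - (h k)`_n| * r ^+ n) (leq_maxl N (size (abs_poly (h l - h k))))).
  rewrite [leRHS](bigID (fun n : 'I__ => (n < N)%N)) /=.
  rewrite -[leLHS]addr0; apply: lerD.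
    by apply: ler_sum => n _; rewrite coef_abs coefB.
  by apply: sumr_ge0 => n _; rewrite coef_abs mulr_ge0// exprn_ge0.
apply/cvgrPdist_lt => e ep.
have : \forall k \near \oo, `|0 - eps k| < e / 2.
  by move/cvgrPdist_lt : e0; apply; rewrite divr_gt0.
have : \forall k \near \oo, `|limn (fun k => (h k).[x]) - (h k).[x]| < e / 2.
  by have /cvgrPdist_lt := cH x xr; apply; rewrite divr_gt0.
move=> E1 E2; have [k _ /(_ k (leqnn k)) [Ek1 Ek2]] := filterI E1 E2.
exists (size (h k)) => // N /= kN.
rewrite -(subrKA ((h k).[x])).
apply: le_lt_trans (ler_normD _ _) _; rewrite [ltRHS]splitr ltr_leD//.
move: Ek2; rewrite sub0r normrN => Ek2.
apply: le_trans (_ : eps k <= _); last exact: le_trans (ler_norm _) (ltW Ek2).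
rewrite distrC; apply: le_trans (tail k N).
rewrite (horner_coef_wide x kN) /pseries /series /= big_mkord -sumrB.
apply: le_trans (ler_norm_sum _ _ _) _; apply: ler_sum => n _.
rewrite -mulrBl normrM ler_wpM2l// normrX.
by rewrite lerXn2r// nnegrE.
Qed.

Lemma cvg_half (D : R) : D / 2 ^+ k @[k --> \oo] --> 0.
Proof.
have -> : (fun k => D / 2 ^+ k) = geometric D (2^-1).
  by apply/funext => k /=; rewrite exprVn.
by apply: cvg_geometric; rewrite ger0_norm; lra.
Qed.

(** Banach iteration where the contraction also varies with [k]: [T k] uses a
    truncation at order [k] of the power series defining the limit map, so that
    all iterates are polynomials.  The truncation errors decrease like [2 ^- k],
    slower than the contraction ratio 1/4, and therefore govern the rate of
    convergence. *)
Lemma wnorm_fixpoint r rho C (T : nat -> {poly R} -> {poly R}) : 0 < r ->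
  0 <= C ->
  (forall k P, wnorm r P <= rho -> wnorm r (T k P) <= rho) ->
  (forall k P Q, wnorm r P <= rho -> wnorm r Q <= rho ->
     wnorm r (T k P - T k Q) <= wnorm r (P - Q) / 4) ->
  (forall k P, wnorm r P <= rho -> wnorm r (T k.+1 P - T k P) <= C / 2 ^+ k) ->
  0 <= rho ->
  exists h : nat -> {poly R},
  [/\ h 0%N = 0, forall k, wnorm r (h k) <= rho, forall k, h k.+1 = T k (h k) &
  exists c (u : R -> R), forall x, `|x| <= r ->
    (fun k => (h k).[x]) @ \oo --> u x /\ pseries c x @ \oo --> u x].
Proof.
move=> r0 C0 Tb Tl Tc rho0; have r0' := ltW r0.
pose h := fix h k := if k is k'.+1 then T k' (h k') else 0.
have hb k : wnorm r (h k) <= rho.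
  by elim: k => [|k IH] /=; [rewrite wnorm0|exact: Tb].
exists h; split=> //.
(* The distance of consecutive iterates is at most [D / 2 ^ k]: in the induction
   step [D / 4 + C <= D / 2]. *)
pose D := rho + 4 * C.
have p2 k : 0 < (2 : R) ^+ k by rewrite exprn_gt0.
have hd k : wnorm r (h k.+1 - h k) <= D / 2 ^+ k.
  elim: k => [|k IH].
    rewrite expr0 divr1 subr0 (le_trans (hb 1%N))// /D; lra.
  have -> : h k.+2 - h k.+1 = (T k.+1 (h k.+1) - T k.+1 (h k)) + (T k.+1 (h k) - T k (h k)).
    by rewrite /= addrA subrK.
  apply: le_trans (wnormD _ _ r0') _.
  have := Tl k.+1 _ _ (hb k.+1) (hb k); have := Tc k _ (hb k).
  rewrite exprS invfM; move: IH; rewrite -/h.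
  have : 0 <= rho * (2 ^+ k)^-1 by rewrite mulr_ge0// invr_ge0 ltW.
  rewrite /D; move: (2 ^+ k)^-1 => z; nra.
apply: (@wnorm_cauchy_pseries r h (fun k => (2 * D) / 2 ^+ k)) => //; last exact: cvg_half.
move=> k l kl; rewrite -(subnK kl); move: (l - k)%N => {l kl} n.
have D0 : 0 <= D by rewrite /D addr_ge0// mulr_ge0.
suff : wnorm r (h (n + k)%N - h k) <= 2 * D / 2 ^+ k - 2 * D / 2 ^+ (n + k).
  by move=> /le_trans; apply; rewrite gerBl mulr_ge0 ?invr_ge0 ?(ltW (p2 _))// mulr_ge0.
elim: n => [|n IH]; first by rewrite !subrr wnorm0.
have -> : h (n.+1 + k)%N - h k = (h (n + k).+1 - h (n + k)%N) + (h (n + k)%N - h k).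
  by rewrite addrA subrK.
apply: le_trans (wnormD _ _ r0') _; have := hd (n + k)%N; move: IH.
rewrite addSn (exprS _ (n + k)) (invfM 2 (2 ^+ (n + k))).
move: (2 ^+ (n+k))^-1 (2 ^+ k)^-1 => z z'; lra.
Qed.

End Limits.

(** * Quotients of analytic functions of one variable *)

Section OneVar.
Variable R : realType.
Implicit Types (f g : R -> R) (a b x y r : R) (c : nat -> R).

(** Neighbourhoods of a real number are handled through explicit radii, which
    can be shrunk by hand. *)
Lemma nearP_dist a (P : R -> Prop) :
  (\forall x \near a, P x) <->
  exists2 e : R, 0 < e & forall x, `|x - a| < e -> P x.
Proof.
split.
  by move=> /nbhs_ballP[e e0 aP]; exists e => // x xa; apply: aP; rewrite -ball_normE /= distrC.
move=> [e e0 aP]; apply/nbhs_ballP; exists e => // x; rewrite -ball_normE /= distrC.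
exact: aP.
Qed.

Definition geom_bounded c (r0 B : R) := forall n, `|c n| * r0 ^+ n <= B.

Lemma analytic1_series f a : analytic1_at f a ->
  exists c (r0 B : R), [/\ 0 < r0, 0 <= B, geom_bounded c r0 B &
    forall x, `|x| < r0 -> pseries c x @ \oo --> f (a + x)].
Proof.
move=> [c /nearP_dist[e e0 ec]].
exists c, (e / 2).
have e2 : 0 < e / 2 by rewrite divr_gt0.
have cv : cvgn (pseries c (e / 2)).
  have := ec (a + e / 2); rewrite addrC addKr => ec'.
  by apply: cvgP; apply: ec'; rewrite ger0_norm ?ltW//; lra.
have [B [Br Bb]] := cvg_series_bounded cv.
exists (`|B| + 1); split=> //.
- move=> n; have := Bb (`|B| + 1); rewrite (le_lt_trans (ler_norm _)) ?ltrDl//.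
  move=> /(_ isT n I) /=; rewrite normrM.
  by rewrite (ger0_norm (exprn_ge0 _ (ltW e2))).
- move=> x xe; have := ec (a + x); rewrite addrC addKr; apply.
  by apply: lt_trans xe _; lra.
Qed.

Lemma geom_bounded_half c r0 B r N : 0 < r0 -> 0 <= r -> r * 2 <= r0 ->
  geom_bounded c r0 B -> `|c N| * r ^+ N <= B / 2 ^+ N.
Proof.
move=> r00 rp rr0 cB; rewrite ler_pdivlMr ?exprn_gt0// -mulrA -exprMn.
apply: le_trans (cB N); rewrite ler_wpM2l// lerXn2r// nnegrE ?(ltW r00)// mulr_ge0//.
Qed.

Lemma wnorm_trunc_bounded c r0 B r N : 0 < r0 -> 0 <= r -> r * 2 <= r0 ->
  geom_bounded c r0 B -> wnorm r (trunc c N) <= 2 * B.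
Proof.
move=> r00 rp rr0 cB; rewrite wnorm_trunc.
have B0 : 0 <= B by apply: le_trans (cB 0%N); rewrite expr0 mulr1.
apply: le_trans (_ : 2 * B - 2 * B / 2 ^+ N <= _); last first.
  by rewrite gerBl divr_ge0 ?mulr_ge0// exprn_ge0.
elim: N => [|N IH]; first by rewrite big_ord0 expr0 divr1 subrr.
rewrite exprS invfM big_ord_recr /=.
have := geom_bounded_half N r00 rp rr0 cB.
move: IH; move: (2 ^+ N)^-1 => z; lra.
Qed.

Lemma geom_boundedS c r0 B r1 : 0 <= r1 -> r1 <= r0 ->
  geom_bounded c r0 B -> geom_bounded c r1 B.
Proof.
move=> r10 r11 cB n; apply: le_trans (cB n).
by rewrite ler_wpM2l// lerXn2r// nnegrE (le_trans r10).
Qed.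

Lemma geom_boundedZ c r0 B (k : R) : geom_bounded c r0 B ->
  geom_bounded (fun n => k * c n) r0 (`|k| * B).
Proof. by move=> cB n; rewrite normrM -mulrA ler_wpM2l. Qed.

(** Without a constant term, shrinking the disc by a factor [s] gains a factor
    [s] in the norm: every monomial that occurs contains the variable at least
    once. *)
Lemma wnorm_trunc_small c r0 B r N (s : R) : 0 < r0 -> 0 <= s <= 1 -> 0 <= r ->
  r * 2 <= s * r0 -> c 0%N = 0 ->
  geom_bounded c r0 B -> wnorm r (trunc c N) <= 2 * B * s.
Proof.
move=> r00 /andP[s0 s1] rp rr0 c0 cB.
have B0 : 0 <= B by apply: le_trans (cB 0%N); rewrite expr0 mulr1.
have [s0'|sN0] := eqVneq s 0.
  have -> : r = 0 by apply/eqP; rewrite eq_le rp andbT; move: rr0; rewrite s0'; lra.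
  rewrite wnorm_trunc s0' mulr0; apply: sumr_le0 => -[[|i] ?] _ /=.
    by rewrite c0 normr0 mul0r.
  by rewrite exprS mul0r mulr0.
have sp : 0 < s by rewrite lt_neqAle eq_sym sN0.
rewrite -mulrA; apply: wnorm_trunc_bounded rp rr0 _; first exact: mulr_gt0.
case=> [|n]; first by rewrite c0 normr0 mul0r mulr_ge0.
rewrite exprMn mulrCA mulrC ler_pM//.
- by rewrite mulr_ge0// exprn_ge0// ltW.
- exact: exprn_ge0.
- by rewrite exprS ler_piMr// exprn_ile1.
Qed.

Lemma pseries0 c : pseries c 0 @ \oo --> c 0%N.
Proof.
apply: cvg_near_cst; exists 1%N => // -[//|n] _.
by rewrite /pseries /series /= big_nat_recl// expr0 mulr1 big1 ?addr0// => i _; rewrite exprS mul0r mulr0.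
Qed.

Lemma cvgn_lim_unique (u : nat -> R) (l l' : R) :
  u @ \oo --> l -> u @ \oo --> l' -> l = l'.
Proof. by move=> ul ul'; apply: cvg_unique ul'. Qed.

(** With [lam = g a], the quotient [u] of [f] by [g] solves
    [u = f / lam + (1 - g / lam) * u].  The series of [1 - g / lam] has no
    constant term, so on a small disc its norm is at most 1/4 and the right-hand
    side contracts. *)
Lemma analytic1_quotient f g a : analytic1_at f a -> analytic1_at g a ->
  g a != 0 -> analytic1_at (fun x => f x / g x) a.
Proof.
move=> /analytic1_series[cf [rf [Bf [rf0 Bf0 cfB fE]]]].
move=> /analytic1_series[cg [rg [Bg [rg0 Bg0 cgB gE]]]] ga0.
pose lam := g a.
have cg0 : cg 0%N = lam.
  apply: (@cvgn_lim_unique (pseries cg 0)); first exact: pseries0.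
  by have := gE 0; rewrite addr0 normr0; apply.
pose r0 := Num.min rf rg.
have r00 : 0 < r0 by rewrite lt_min rf0.
pose ca n := lam^-1 * cf n.
pose cq n := if n == 0%N then 0 else - lam^-1 * cg n.
pose B := `|lam^-1| * (Bf + Bg).
have B0 : 0 <= B by rewrite mulr_ge0// addr_ge0.
have caB : geom_bounded ca r0 B.
  move=> n; apply: le_trans (geom_boundedZ lam^-1 (geom_boundedS (ltW r00) _ cfB) n) _.
    by rewrite ge_min lexx.
  by rewrite ler_wpM2l// lerDl.
have cqB : geom_bounded cq r0 B.
  move=> n; rewrite /cq; case: eqP => _; first by rewrite normr0 mul0r.
  apply: le_trans (geom_boundedZ (- lam^-1) (geom_boundedS (ltW r00) _ cgB) n) _.
    by rewrite ge_min lexx orbT.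
  by rewrite normrN ler_wpM2l// lerDr.
clearbody B.
(* On the disc shrunk by [s], the series of [1 - g / lam] has norm at most
   [2 * B * s <= 1/4]. *)
pose s := (8 * B + 1)^-1.
have B1 : 0 < 8 * B + 1 by lra.
have s0 : 0 < s by rewrite invr_gt0.
have sB : 8 * B * s <= 1 by rewrite ler_pdivrMr; lra.
have s1 : s <= 1 by rewrite invf_le1//; lra.
pose r := s * r0 / 2.
have r_gt0 : 0 < r by rewrite divr_gt0// mulr_gt0.
have r2 : r * 2 <= s * r0 by rewrite /r divfK.
have r2' : r * 2 <= r0 by apply: le_trans r2 _; rewrite ler_piMl// ltW.
have rlt : r < r0 by lra.
have qN N : wnorm r (trunc cq N) <= 4^-1.
  have := @wnorm_trunc_small cq r0 B r N s r00 _ (ltW r_gt0) r2 _ cqB.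
  rewrite (ltW s0) s1 => /(_ isT erefl) /le_trans; apply; lra.
have aN N : wnorm r (trunc ca N) <= 2 * B.
  exact: wnorm_trunc_bounded r00 (ltW r_gt0) r2' caB.
pose T k P := trunc ca k + trunc cq k * P.
have := @wnorm_fixpoint R r (4 * B) (B + B * (4 * B)) T r_gt0.
have rge0 := ltW r_gt0.
case.
- by rewrite addr_ge0// !mulr_ge0.
- move=> k P PB; apply: le_trans (wnormD _ _ rge0) _.
  have := le_trans (wnormM _ _ rge0) (ler_pM (wnorm_ge0 _ rge0) (wnorm_ge0 _ rge0) (qN k) PB).
  have := aN k; lra.
- move=> k P Q PB QB; have -> : T k P - T k Q = (P - Q) * trunc cq k by rewrite /T; ring.
  apply: le_trans (wnormM _ _ rge0) _.
  by rewrite ler_wpM2l// wnorm_ge0.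
- move=> k P PB; rewrite /T !truncS.
  have -> : trunc ca k + (ca k)%:P * 'X^k + (trunc cq k + (cq k)%:P * 'X^k) * P
     - (trunc ca k + trunc cq k * P) = (ca k)%:P * 'X^k + (cq k)%:P * 'X^k * P by ring.
  apply: le_trans (wnormD _ _ rge0) _; rewrite mulrDl.
  have h1 := geom_bounded_half k r00 rge0 r2' caB.
  have h2 := geom_bounded_half k r00 rge0 r2' cqB.
  apply: lerD; first by rewrite wnorm_monom.
  apply: le_trans (wnormM _ _ rge0) _; rewrite mulrAC.
  by rewrite ler_pM ?wnorm_ge0// wnorm_monom.
- by rewrite mulr_ge0.
move=> h [_ hB hT [c [u hu]]].
exists c; apply/nearP_dist; exists r => // x xr.
have [hx cx] := hu _ (ltW xr).
suff -> : f x / g x = u (x - a) by [].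
have xr0 := lt_trans xr rlt.
have Ax : (fun k => (trunc ca k).[x - a]) @ \oo --> lam^-1 * f x.
  have -> : (fun k => (trunc ca k).[x - a]) = (fun k => lam^-1 * pseries cf (x - a) k).
    apply/funext => k; rewrite trunc_horner /pseries /series /= mulr_sumr.
    by apply: eq_bigr => i _; rewrite mulrA.
  apply: cvgMl_tmp; rewrite -[in f _](subrKC a x); apply: fE.
  by apply: lt_le_trans xr0 _; rewrite ge_min lexx.
have Qx : (fun k => (trunc cq k).[x - a]) @ \oo --> 1 - lam^-1 * g x.
  have Gx : (fun k => 1 - lam^-1 * pseries cg (x - a) k) @ \oo --> 1 - lam^-1 * g x.
    apply: cvgB; first exact: cvg_cst.
    apply: cvgMl_tmp; rewrite -[in g _](subrKC a x); apply: gE.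
    by apply: lt_le_trans xr0 _; rewrite ge_min lexx orbT.
  apply: cvg_trans Gx; apply: near_eq_cvg; exists 1%N => // -[//|k] _ /=.
  rewrite trunc_horner /pseries /series /= !big_nat_recl// !expr0 !mulr1 cg0.
  rewrite mulrDr mulVf// /cq /= add0r opprD addNKr mulr_sumr -sumrN.
  by apply: eq_bigr => i _; ring.
have fix_u : u (x - a) = lam^-1 * f x + (1 - lam^-1 * g x) * u (x - a).
  apply: (@cvgn_lim_unique (fun k => (h k.+1).[x - a])); first by rewrite (cvg_shiftS (fun k => (h k).[x - a])).
  have -> : (fun k => (h k.+1).[x - a]) =
     (fun k => (trunc ca k).[x - a] + (trunc cq k).[x - a] * (h k).[x - a]).
    by apply/funext => k; rewrite hT /T hornerD hornerM.
  by apply: cvgD => //; apply: cvgM.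
have Qle : `|1 - lam^-1 * g x| <= 4^-1.
  have /cvg_norm/cvgr_to_le := Qx; apply; exists 0%N => // k _ /=.
  by apply: le_trans (qN k); apply: horner_le_wnorm; exact: ltW.
have gx0 : g x != 0.
  by apply: contraTneq Qle => ->; rewrite mulr0 subr0 normr1 -ltNge; lra.
have lam0 : lam != 0 by [].
have E : lam^-1 * (g x * u (x - a)) = lam^-1 * f x.
  by apply/eqP; rewrite -subr_eq0; apply/eqP; move: fix_u; move: (u _) => z; lra.
have {}E := mulfI (invr_neq0 lam0) E.
by rewrite -E mulrC mulKf.
Qed.

End OneVar.

(** * Derivatives and primitives *)

Section OneVar2.
Variable R : realType.
Implicit Types (f g : R -> R) (a b x y r : R) (c : nat -> R).

Lemma analytic1_near_eq f g a : (\forall x \near a, f x = g x) ->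
  analytic1_at f a -> analytic1_at g a.
Proof. by move=> fg [c cf]; exists c; move: fg cf; apply: filterS2 => x <-. Qed.

Lemma analytic1_addl (k : R) f a : analytic1_at f a ->
  analytic1_at (fun x => k + f x) a.
Proof.
move=> [c cf]; exists (fun n => if n == 0%N then k + c 0%N else c n).
near=> x; have fx : pseries c (x - a) @ \oo --> f x by near: x.
have : (fun N => k + pseries c (x - a) N) @ \oo --> k + f x.
  by apply: cvgD => //; exact: cvg_cst.
apply: cvg_trans; apply: near_eq_cvg; exists 1%N => // -[//|N] _.
by rewrite /pseries /series /= !big_nat_recl// !expr0 !mulr1 addrA.
Unshelve. all: by end_near. Qed.

Lemma analytic1_cst (k : R) a : analytic1_at (fun=> k) a.
Proof.
exists (fun n => if n == 0%N then k else 0); near=> x.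
apply: cvg_near_cst; exists 1%N => // -[//|N] _.
rewrite /pseries /series /= big_nat_recl// expr0 mulr1 big1 ?addr0//= => i _.
by rewrite mul0r.
Unshelve. all: by end_near. Qed.

Lemma succ_le_exp2 n : (n.+1 <= 2 ^ n)%N.
Proof. exact: ltn_expl. Qed.

(** Halving the radius absorbs the factor [n + 1] created by differentiation,
    as [n + 1 <= 2 ^ n]. *)
Lemma geom_bounded_diffs c r0 (B : R) : 0 < r0 -> geom_bounded c r0 B ->
  geom_bounded (pseries_diffs c) (r0 / 2) (B / r0).
Proof.
move=> r00 cB n; rewrite ler_pdivlMr// /pseries_diffs normrM expr_div_n.
have p2 : 0 < (2 : R) ^+ n by rewrite exprn_gt0.
apply: le_trans (cB n.+1); rewrite exprS (ger0_norm (ler0n _ _)).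
have -> : n.+1%:R * `|c n.+1| * (r0 ^+ n / 2 ^+ n) * r0 =
   (n.+1%:R / 2 ^+ n) * (`|c n.+1| * (r0 * r0 ^+ n)) by field; rewrite gt_eqF.
rewrite ler_piMl ?mulr_ge0 ?exprn_ge0 ?(ltW r00)//.
by rewrite ler_pdivrMr// mul1r -natrX ler_nat succ_le_exp2.
Qed.

Lemma geom_bounded_cvg c r0 (B : R) x : 0 < r0 -> geom_bounded c r0 B ->
  `|x| * 2 <= r0 -> cvgn (pseries c x).
Proof.
move=> r00 cB xr; apply: normed_cvg; apply: nondecreasing_is_cvgn.
  by apply: nondecreasing_series => n _ _ /=.
exists (2 * B) => _ [N _ <-].
apply: le_trans (wnorm_trunc_bounded N r00 (normr_ge0 x) xr cB).
rewrite wnorm_trunc /normed_series_of /series /= big_mkord.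
by apply: ler_sum => i _; rewrite normrM normrX.
Qed.

Lemma pseries_is_derive c r0 (B : R) x : 0 < r0 -> geom_bounded c r0 B ->
  `|x| < r0 / 8 ->
  is_derive x 1 (fun x => limn (pseries c x)) (limn (pseries (pseries_diffs c) x)).
Proof.
move=> r00 cB xr.
have r2 : 0 < r0 / 2 by rewrite divr_gt0.
have r4 : 0 < r0 / 2 / 2 by rewrite divr_gt0.
have dB := geom_bounded_diffs r00 cB.
have ddB := geom_bounded_diffs r2 dB.
have n8 : `|r0 / 8| = r0 / 8 by rewrite ger0_norm// divr_ge0// ltW.
(* Two differentiations halve the radius twice, and convergence is only claimed
   on half of the remaining radius. *)
apply: (@pseries_snd_diffs R c (r0 / 8)).
- by apply: (geom_bounded_cvg r00 cB); rewrite n8; lra.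
- by apply: (geom_bounded_cvg r2 dB); rewrite n8; lra.
- by apply: (geom_bounded_cvg r4 ddB); rewrite n8; lra.
- by rewrite n8.
Qed.

Lemma series_is_derive c r0 (B : R) f a : 0 < r0 -> geom_bounded c r0 B ->
  (forall x, `|x| < r0 -> pseries c x @ \oo --> f (a + x)) ->
  forall x, `|x - a| < r0 / 8 ->
  is_derive x 1 f (limn (pseries (pseries_diffs c) (x - a))).
Proof.
move=> r00 cB cf x xr.
have ds : is_derive x 1 (fun y => y - a : R) (1 : R).
  by apply: is_derive_eq; rewrite oppr0 addr0.
have := @is_derive1_comp _ _ (fun y => y - a) x _ _ (pseries_is_derive r00 cB xr) ds.
rewrite mulr1; apply: near_eq_is_derive.
apply/nearP_dist; exists (r0 / 8 - `|x - a|); first by rewrite subr_gt0.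
move=> y yx /=; apply/cvg_lim => //; rewrite -{2}(subrKC a y); apply: cf.
have := ler_distD x y a; lra.
Qed.

Lemma analytic1_derivable f a : analytic1_at f a ->
  \forall x \near a, derivable f x 1.
Proof.
move=> /analytic1_series[c [r0 [B [r00 B0 cB cf]]]].
apply/nearP_dist; exists (r0 / 8) => [|x xr]; first by rewrite divr_gt0.
by have [] := series_is_derive r00 cB cf xr.
Qed.

Lemma analytic1_derive1 f a : analytic1_at f a -> analytic1_at (derive1 f) a.
Proof.
move=> /analytic1_series[c [r0 [B [r00 B0 cB cf]]]].
exists (pseries_diffs c); apply/nearP_dist.
exists (r0 / 8) => [|x xr]; first by rewrite divr_gt0.
have [_] := series_is_derive r00 cB cf xr; rewrite derive1E => ->.
have r2 : 0 < r0 / 2 by rewrite divr_gt0.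
by apply: (geom_bounded_cvg r2 (geom_bounded_diffs r00 cB)); lra.
Qed.

Lemma analytic1_continuous f a : analytic1_at f a -> {for a, continuous f}.
Proof.
move=> /analytic1_derivable/nbhs_singleton da.
exact/differentiable_continuous/derivable1_diffP.
Qed.

Lemma derive0_const f a (e : R) :
  (forall x, `|x - a| < e -> is_derive x 1 f 0) ->
  forall x, `|x - a| < e -> f x = f a.
Proof.
move=> df.
have df' x : `|x - a| < e -> {for x, continuous f}.
  by move=> /df[d _]; exact/differentiable_continuous/derivable1_diffP.
have key u v : u <= v -> (forall t, u <= t <= v -> `|t - a| < e) -> f u = f v.
  move=> uv ut; have [||t _ /eqP] := @MVT_segment _ f (fun=> 0) u v uv.
  - by move=> t; rewrite in_itv /= => /andP[? ?]; apply/df/ut; rewrite !ltW.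
  - apply: derivable_within_continuous => t.
    by rewrite in_itv /= => tuv; have [] := df _ (ut _ tuv).
  - by rewrite mul0r subr_eq0 => /eqP.
move=> x xa; have [ax|xa'] := leP a x.
  apply/esym/key => // t /andP[at_ tx]; apply: le_lt_trans xa.
  by rewrite !ger0_norm ?subr_ge0// lerD2r.
apply: key; first exact: ltW.
move=> t /andP[xt ta]; apply: le_lt_trans xa.
by rewrite !ler0_norm ?subr_le0// ?lerN2 ?lerD2r// ltW.
Qed.

Lemma analytic1_primitive (beta : R -> R) a : analytic1_at beta a ->
  exists h, [/\ h a = 0, analytic1_at h a &
    \forall x \near a, is_derive (x : R) (1 : R) h (beta x)].
Proof.
move=> /analytic1_series[c [r0 [B [r00 B0 cB cf]]]].
pose p n := if n is n'.+1 then c n' / n'.+1%:R else 0.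
have pB : geom_bounded p r0 (B * r0).
  case=> [|n]; first by rewrite normr0 mul0r mulr_ge0// ltW.
  rewrite /p exprS mulrCA mulrC ler_wpM2r ?(ltW r00)//.
  apply: le_trans (cB n); rewrite ler_wpM2r ?exprn_ge0 ?(ltW r00)//.
  rewrite normrM ler_piMr// normfV invf_le1 ?normr_gt0 ?pnatr_eq0//.
  by rewrite ger0_norm// ler1n.
have dp : pseries_diffs p = c.
  by apply/funext => n; rewrite /pseries_diffs /p mulrC divfK// pnatr_eq0.
pose h x := limn (pseries p (x - a)).
have hE x : `|x| < r0 / 2 -> pseries p x @ \oo --> h (a + x).
  move=> xr; rewrite /h addrC addKr; apply: (geom_bounded_cvg r00 pB); lra.
exists h; split.
- by rewrite /h subrr; apply/cvg_lim => //; exact: pseries0.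
- exists p; apply/nearP_dist; exists (r0 / 2) => [|x xr]; first by rewrite divr_gt0.
  by rewrite -{2}(subrKC a x); exact: hE.
- apply/nearP_dist; exists (r0 / 2 / 8) => [|x xr]; first by rewrite !divr_gt0.
  have r2 : 0 < r0 / 2 by rewrite divr_gt0.
  have pB2 : geom_bounded p (r0 / 2) (B * r0).
    by apply: geom_boundedS pB; lra.
  have := series_is_derive r2 pB2 hE xr; rewrite dp => /is_derive_eq; apply.
  apply/cvg_lim => //; rewrite -[in beta _](subrKC a x); apply: cf; lra.
Qed.

(** The primitive of the local expansion of [beta] at [a] differs from [f] by a
    constant.  This gives the analyticity of a given primitive at points other
    than the centre of its expansion without re-expanding a power series. *)
Lemma analytic1_of_derive f (beta : R -> R) a : analytic1_at beta a ->
  (\forall x \near a, is_derive (x : R) (1 : R) f (beta x)) -> analytic1_at f a.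
Proof.
move=> /analytic1_primitive[h [h0 ha hd]] fd.
have [e e0 fh] : exists2 e : R, 0 < e & forall x, `|x - a| < e ->
    is_derive x 1 h (beta x) /\ is_derive x 1 f (beta x).
  apply/nearP_dist; near=> x; split; first by near: x.
  by near: x.
have fhd x : `|x - a| < e -> is_derive x 1 (fun y => f y - h y) 0.
  by move=> /fh[dh df]; apply: is_derive_eq; rewrite subrr.
apply: analytic1_near_eq (analytic1_addl (f a) ha).
apply/nearP_dist; exists e => // x /(derive0_const fhd).
by rewrite h0 subr0 => <-; rewrite subrK.
Unshelve. all: by end_near. Qed.

End OneVar2.

(** * Local inverses *)

Section Inverse.
Variable R : realType.
Implicit Types (f g : R -> R) (a b x y r : R) (c : nat -> R).

Lemma deriv_abs_trunc c rho N :
  (abs_poly (trunc c N.+1))^`().[rho] = wnorm rho (trunc (pseries_diffs c) N).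
Proof.
rewrite /wnorm; congr horner; apply/polyP => i.
rewrite coef_deriv !coef_abs !coef_poly ltnS; case: ifP => _.
  by rewrite /pseries_diffs normrM ger0_norm// mulr_natl.
by rewrite normr0 mul0rn.
Qed.

(** Writing [f (b + u) = f b + lam * u + (higher terms)], the equation
    [f (b + u) = f b + y] becomes [u = y / lam + N (u)], where [N] starts at order
    two.  On small discs [N] is a contraction with respect to substitution, and
    its iterates starting from 0 are polynomials in [y] without constant term. *)
Lemma analytic1_local_inverse f b (lam : R) : analytic1_at f b ->
  is_derive b (1 : R) f lam -> lam != 0 ->
  exists u, [/\ analytic1_at u (f b), u (f b) = b &
    \forall y \near f b, f (u y) = y].
Proof.
move=> /analytic1_series[c [r0 [B [r00 B0 cB cf]]]] df lam0.
have c0 : c 0%N = f b.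
  apply: (@cvgn_lim_unique _ (pseries c 0)); first exact: pseries0.
  by have := cf 0; rewrite addr0 normr0; apply.
have c1 : c 1%N = lam.
  have b8 : `|b - b| < r0 / 8 by rewrite subrr normr0 divr_gt0.
  have [_ dE] := series_is_derive r00 cB cf b8.
  have [_ <-] := df; rewrite dE subrr.
  have -> : limn (pseries (pseries_diffs c) 0) = pseries_diffs c 0%N.
    by apply/cvg_lim => //; exact: pseries0.
  by rewrite /pseries_diffs mul1r.
pose a n := if (n < 2)%N then 0 else - lam^-1 * c n.
pose B' := `|lam^-1| * B.
have B'0 : 0 <= B' by rewrite mulr_ge0.
have aB : geom_bounded a r0 B'.
  move=> n; rewrite /a; case: ifP => _; first by rewrite normr0 mul0r.
  by have := geom_boundedZ (- lam^-1) cB n; rewrite normrN.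
clearbody B'.
have daB := geom_bounded_diffs r00 aB.
have r20 : 0 < r0 / 2 by rewrite divr_gt0.
pose M := B' / r0.
have M0 : 0 <= M by rewrite divr_ge0// ltW.
(* On the disc shrunk by [s], the Lipschitz constant of substitution into the
   nonlinear part is at most [2 * M * s <= 1/4]. *)
pose s := (8 * M + 1)^-1.
have M1 : 0 < 8 * M + 1 by lra.
have s0 : 0 < s by rewrite invr_gt0.
have sM : 8 * M * s <= 1 by rewrite ler_pdivrMr; lra.
have s1 : s <= 1 by rewrite invf_le1//; lra.
pose rho := s * (r0 / 2) / 2.
have rho_gt0 : 0 < rho by rewrite divr_gt0// mulr_gt0.
have rho2 : rho * 2 <= s * (r0 / 2) by rewrite /rho divfK.
have rho_r0 : rho * 2 <= r0 / 2.
  by apply: le_trans rho2 _; rewrite ler_piMl// ltW.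
have rho2' : rho * 2 <= r0 by lra.
have rho0 := ltW rho_gt0.
(* The linear term [y / lam] then takes up half of the radius [rho]. *)
pose r := rho * `|lam| / 2.
have r_gt0 : 0 < r by rewrite divr_gt0// mulr_gt0// normr_gt0.
have rge0 := ltW r_gt0.
have lip N : (abs_poly (trunc a N))^`().[rho] <= 4^-1.
  case: N => [|N].
    have -> : trunc a 0 = 0 by apply/polyP => i; rewrite coef_poly coef0.
    by rewrite abs_poly0 deriv0 horner0 invr_ge0.
  rewrite deriv_abs_trunc.
  have := @wnorm_trunc_small _ _ _ _ rho N s r20 _ rho0 rho2 _ daB.
  rewrite (ltW s0) s1 /pseries_diffs /a mulr0 -/M => /(_ isT erefl) /le_trans; apply; lra.
pose T k P := lam^-1%:P * 'X + (trunc a k \Po P).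
have := @wnorm_fixpoint R r rho B' T r_gt0 B'0.
case.
- move=> k P PB; apply: le_trans (wnormD _ _ rge0) _.
  rewrite -['X]expr1 wnorm_monom// expr1.
  have -> : `|lam^-1| * r = rho / 2.
    by rewrite /r normfV; field; rewrite normr_eq0.
  have := @wnorm_comp_lip R r rho (trunc a k) P 0 rge0 PB.
  rewrite wnorm0 => /(_ rho0); rewrite comp_poly0r coef_poly /a /= if_same subr0 subr0.
  have := ler_wpM2r (wnorm_ge0 P rge0) (lip k); lra.
- move=> k P Q PB QB; rewrite /T.
  have -> (x y z : {poly R}) : x + y - (x + z) = y - z by ring.
  apply: le_trans (@wnorm_comp_lip R r rho (trunc a k) P Q rge0 PB QB) _.
  by rewrite mulrC ler_wpM2l// wnorm_ge0.
- move=> k P PB; rewrite /T truncS comp_polyD.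
  have -> (x y z : {poly R}) : x + (y + z) - (x + y) = z by ring.
  apply: le_trans (wnorm_comp _ rge0 PB) _; rewrite wnorm_monom//.
  exact: geom_bounded_half r00 rho0 rho2' aB.
- by [].
move=> h [h0 hB hT [cu [u hu]]].
have u0 : u 0 = 0.
  have [hu0 _] := hu 0 (eq_ind_r (fun z => z <= r) rge0 (normr0 _)).
  apply: cvgn_lim_unique hu0 _; rewrite (_ : (fun _ => _) = fun=> 0); first exact: cvg_cst.
  apply/funext; elim=> [|k IH]; first by rewrite h0 horner0.
  rewrite hT /T hornerD hornerM hornerX mulr0 add0r horner_comp IH.
  by rewrite horner_coef0 coef_poly /a if_same.
have ur y : `|y| <= r -> `|u y| <= rho.
  move=> yr; have [/cvg_norm/cvgr_to_le huy _] := hu _ yr.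
  apply: huy; exists 0%N => // k _ /=; apply: le_trans (hB k).
  exact: horner_le_wnorm.
have fu y : `|y| <= r -> f (b + u y) = f b + y.
  move=> yr; have uyr := ur _ yr; have [hy _] := hu _ yr.
  have fuy : pseries c (u y) @ \oo --> f (b + u y) by apply: cf; lra.
  have Ay : (fun k => (trunc a k).[u y]) @ \oo --> u y - lam^-1 * (f (b + u y) - f b).
    have Gy : (fun k => u y - lam^-1 * (pseries c (u y) k - f b)) @ \oo -->
        u y - lam^-1 * (f (b + u y) - f b).
      apply: cvgB; first exact: cvg_cst.
      apply: cvgMl_tmp; apply: cvgB => //; exact: cvg_cst.
    apply: cvg_trans Gy; apply: near_eq_cvg; exists 2%N => // -[//|[//|k]] _ /=.
    rewrite trunc_horner /pseries /series /= !big_nat_recl// /a /= c0 c1.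
    rewrite [X in _ = _ + (_ + X)](_ : _ =
        - lam^-1 * \sum_(0 <= i < k) c i.+2 * u y ^+ i.+2); last first.
      by rewrite mulr_sumr; apply: eq_bigr => i _; ring.
    by field.
  have fixu : u y = lam^-1 * y + (u y - lam^-1 * (f (b + u y) - f b)).
    apply: (@cvgn_lim_unique _ (fun k => (h k.+1).[y])).
      by rewrite (cvg_shiftS (fun k => (h k).[y])).
    have -> : (fun k => (h k.+1).[y]) = (fun k => lam^-1 * y +
         ((trunc a k).[u y] + ((trunc a k).[(h k).[y]] - (trunc a k).[u y]))).
      by apply/funext => k; rewrite subrKC hT /T hornerD hornerM hornerC hornerX horner_comp.
    apply: cvgD; first exact: cvg_cst.
    rewrite -[X in _ --> X]addr0; apply: cvgD => //.
    apply/cvgr0Pnorm_lt => e e0; have /cvgrPdist_lt/(_ e e0) := hy.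
    apply: filterS => k; rewrite distrC; apply: le_lt_trans.
    apply: le_trans (horner_lip _ _ uyr) _.
      by apply: le_trans (hB k); apply: horner_le_wnorm.
    by rewrite -[leRHS]mul1r ler_wpM2r// (le_trans (lip k))//; lra.
  have {}fixu : lam^-1 * (f (b + u y) - f b) = lam^-1 * y.
    by move: fixu; move: (f (b + _)) => z; lra.
  by have /eqP := mulfI (invr_neq0 lam0) fixu; rewrite subr_eq => /eqP ->; rewrite addrC.
exists (fun y => b + u (y - f b)); split.
- apply: analytic1_addl; exists cu; apply/nearP_dist; exists r => // y yr.
  by have [] := hu _ (ltW yr).
- by rewrite subrr u0 addr0.
- apply/nearP_dist; exists r => // y yr.
  by rewrite fu ?subrKC// ltW.
Qed.

End Inverse.

(** * Analytic coordinates with a prescribed derivative *)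

Section Coordinate.
Variable R : realType.
Implicit Types (f g : R -> R) (a b x y r : R) (c : nat -> R).

(** Rolle's theorem on the segment between two points with the same image. *)
Lemma derive_neq0_inj f (beta : R -> R) a (e : R) :
  (forall x, `|x - a| < e -> is_derive x (1 : R) f (beta x)) ->
  (forall x, `|x - a| < e -> beta x != 0) ->
  forall x y, `|x - a| < e -> `|y - a| < e -> f x = f y -> x = y.
Proof.
move=> df b0.
have main x y : x < y -> `|x - a| < e -> `|y - a| < e -> f x = f y -> False.
  move=> xy xe ye fxy.
  have xye t : x <= t <= y -> `|t - a| < e.
    by move: xe ye; rewrite !ltr_distl => /andP[? ?] /andP[? ?] /andP[? ?]; lra.
  have [||t] := @MVT _ f beta x y xy.
  - by move=> t; rewrite in_itv /= => /andP[? ?]; apply/df/xye; rewrite !ltW.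
  - apply: derivable_within_continuous => t.
    by rewrite in_itv /= => txy; have [] := df _ (xye _ txy).
  - rewrite in_itv /= => /andP[xt ty] /eqP; rewrite fxy subrr eq_sym mulf_eq0.
    rewrite subr_eq0 (gt_eqF xy) orbF; apply/negP/b0/xye.
    by rewrite !ltW.
move=> x y xe ye fxy; case: (ltgtP x y) => // [xy|yx].
  by case: (main x y).
by case: (main y x).
Qed.

(** The coordinate [f] is a primitive of [beta], and [g] is its local inverse at
    [0 = f a].  Analyticity of [g] away from 0 comes from the local inverses of
    [f] at the nearby points: they coincide with [g] because [f] is injective. *)
Lemma analytic1_coordinate (beta : R -> R) a (e0 : R) : 0 < e0 ->
  (forall x, `|x - a| < e0 -> analytic1_at beta x) -> beta a != 0 ->
  exists f g (e eta : R), [/\ 0 < e <= e0, 0 < eta, f a = 0 &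
    [/\ forall x, `|x - a| < e -> [/\ analytic1_at f x,
          is_derive x (1 : R) f (beta x) & beta x != 0],
       forall y, `|y| < eta -> [/\ `|g y - a| < e, f (g y) = y &
          analytic1_at g y] &
       forall x, `|x - a| < e -> `|f x| < eta -> g (f x) = x]].
Proof.
move=> e00 ba b0.
have baa : analytic1_at beta a by apply: ba; rewrite subrr normr0.
have [f [f0 fa fd]] := analytic1_primitive baa.
have : \forall x \near a, [/\ `|x - a| < e0, is_derive (x : R) (1 : R) f (beta x) &
     beta x != 0].
  have bc := analytic1_continuous baa.
  near=> x; split.
  - by near: x; apply/nearP_dist; exists e0.
  - by near: x.
  - by near: x; exact: (cvgr_neq0 _ bc b0).
move=> /nearP_dist[e' e'0 eP].
pose e := Num.min e0 e'.
have e_gt0 : 0 < e by rewrite lt_min e00.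
have eP' x : `|x - a| < e -> [/\ `|x - a| < e0, is_derive (x : R) (1 : R) f (beta x) &
     beta x != 0].
  by move=> xe; apply: eP; apply: lt_le_trans xe _; rewrite ge_min lexx orbT.
have fan x : `|x - a| < e -> analytic1_at f x.
  move=> xe; have [xe0 _ _] := eP' _ xe.
  apply: analytic1_of_derive (ba _ xe0) _.
  apply/nearP_dist; exists (e - `|x - a|); first by rewrite subr_gt0.
  move=> y yx; have [] // := eP' y; have := ler_distD x y a; lra.
have finj : forall x y, `|x - a| < e -> `|y - a| < e -> f x = f y -> x = y.
  by apply: (@derive_neq0_inj f beta a e) => x /eP'[].
have a0e : `|a - a| < e by rewrite subrr normr0.
have [_ fda _] := eP' _ a0e.
have inv_near b : `|b - a| < e -> exists u, [/\ analytic1_at u (f b), u (f b) = b &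
    \forall y \near f b, f (u y) = y /\ `|u y - a| < e].
  move=> be; have [_ fdb bb] := eP' _ be.
  have [u [ua ub uf]] := analytic1_local_inverse (fan _ be) fdb bb.
  have /cvgrPdist_lt uc := analytic1_continuous ua.
  have eb : 0 < e - `|b - a| by rewrite subr_gt0.
  exists u; split => //; near=> y; split; first by near: y.
  near: y; apply: filterS (uc _ eb) => y /=; rewrite ub => yb.
  have := ler_distD b (u y) a; rewrite (distrC (u y) b); lra.
have [g [ga g0]] := inv_near _ a0e; rewrite f0 => /nearP_dist[eta eta0 gP].
exists f, g, e, eta; split => //.
  by rewrite e_gt0 ge_min lexx.
split.
- by move=> x xe; have [_ ? ?] := eP' _ xe; split => //; exact: fan.
- move=> y yeta; have [] := gP y; first by rewrite subr0.
  move=> fgy gye; split=> //.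
  have [v [va vb]] := inv_near _ gye; rewrite fgy in va vb *.
  move=> vP; apply: analytic1_near_eq va; near=> z.
  have [fvz vze] : f (v z) = z /\ `|v z - a| < e by near: z.
  have [fgz gze] : f (g z) = z /\ `|g z - a| < e.
    apply: gP; rewrite subr0; near: z; apply/nearP_dist; exists (eta - `|y|); first by rewrite subr_gt0.
    move=> z zy; have := ler_distD y z 0; rewrite !subr0; lra.
  by apply: finj => //; rewrite fvz fgz.
- move=> x xe fxe; have [] := gP (f x); first by rewrite subr0.
  by move=> fgf gfe; apply: finj.
Unshelve. all: by end_near. Qed.

Lemma is_derive_local_inverse f g y (d : R) : f (g y) = y ->
  (\forall z \near y, f (g z) = z) -> derivable g y 1 ->
  is_derive (g y) (1 : R) f d -> d != 0 /\ is_derive y (1 : R) g d^-1.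
Proof.
move=> fgy fgz gd fd.
have gd' : is_derive y (1 : R) g ('D_1 g y) by exact: derivableP.
have c := is_derive1_comp fd gd'.
have c' : is_derive y (1 : R) (f \o g) (1 : R).
  apply: near_eq_is_derive (is_derive_id y (1 : R)).
  by apply: filterS fgz => z /= ->.
have E : d * 'D_1 g y = 1 by have [_ <-] := c; have [_ ->] := c'.
have d0 : d != 0.
  by apply/eqP => dz; move: E; rewrite dz mul0r => /esym/eqP; rewrite oner_eq0.
by split => //; apply: is_derive_eq gd' _; apply: (mulfI d0); rewrite E mulfV.
Qed.

End Coordinate.

(** * Sums over multi-indices *)

Section SeveralVar.
Variables (R : realType) (d : nat).
Implicit Types (F G : 'rV[R]_d -> R) (p x v w : 'rV[R]_d) (r B : R).
Implicit Types (c : ('I_d -> nat) -> R) (t : ('I_d -> nat) -> R) (i : 'I_d).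

(** Partial sums run over cubes of multi-indices of varying sizes, which are
    different types; this identifies a cube with a part of a larger one. *)
Lemma cube_restrict (t : ('I_d -> nat) -> R) N K : (N <= K)%N ->
  \sum_(m : {ffun 'I_d -> 'I_K} | [forall i, (m i < N)%N]) t (fun i => m i) =
  \sum_(m : {ffun 'I_d -> 'I_N}) t (fun i => m i).
Proof.
move=> NK; pose h (m : {ffun 'I_d -> 'I_N}) := [ffun i => widen_ord NK (m i)].
have h_inj : injective h.
  move=> m m' /ffunP E; apply/ffunP => i; apply/val_inj.
  by have := congr1 val (E i); rewrite !ffunE.
transitivity (\sum_(m in [set h x | x in [set: {ffun 'I_d -> 'I_N}]]%SET) t (fun i => m i)).
  apply: eq_bigl => m; apply/forallP/imsetP => [mN|[m' _ -> i]]; last by rewrite ffunE /=.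
  exists [ffun i => Ordinal (mN i)]; first by rewrite inE.
  by apply/ffunP => i; rewrite !ffunE; apply/val_inj.
rewrite big_imset; last by move=> ? ? _ _; exact: h_inj.
apply: eq_big => [m|m _]; first by rewrite inE.
by congr t; apply/funext => i; rewrite ffunE.
Qed.

(** The exponent of [v i * v ^ m]. *)
Definition shift_idx i (m : 'I_d -> nat) : 'I_d -> nat :=
  fun j => if j == i then (m j).+1 else m j.

Lemma cube_shift (t : ('I_d -> nat) -> R) i N :
  \sum_(m : {ffun 'I_d -> 'I_N.+1} |
     (0 < m i)%N && [forall j, (j == i) || (m j < N)%N]) t (fun j => m j) =
  \sum_(m : {ffun 'I_d -> 'I_N}) t (shift_idx i (fun j => m j)).
Proof.
have bnd (m : {ffun 'I_d -> 'I_N}) j : (shift_idx i (fun j => m j) j < N.+1)%N.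
  by rewrite /shift_idx; case: eqP => _; rewrite ltnS// ltnW.
pose h (m : {ffun 'I_d -> 'I_N}) := [ffun j => Ordinal (bnd m j)].
have h_inj : injective h.
  move=> m m' /ffunP E; apply/ffunP => j; apply/val_inj.
  have := congr1 val (E j); rewrite !ffunE /= /shift_idx.
  by case: eqP => // _ [].
transitivity (\sum_(m in [set h x | x in [set: {ffun 'I_d -> 'I_N}]]%SET) t (fun i => m i)).
  apply: eq_bigl => m; apply/andP/imsetP => [[mi /forallP mN]|[m' _ ->]]; last first.
    rewrite ffunE /= /shift_idx eqxx; split=> //; apply/forallP => j.
    by rewrite ffunE /= /shift_idx; case: eqP => //= _.
  have mN' j : ((if j == i then (m j).-1 else m j) < N)%N.
    case: eqP => [->|/eqP ji]; last by have := mN j; rewrite (negbTE ji).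
    by have := ltn_ord (m i); rewrite -{1}(prednK mi) ltnS.
  exists [ffun j => Ordinal (mN' j)]; first by rewrite inE.
  apply/ffunP => j; apply/val_inj; rewrite !ffunE /= /shift_idx ffunE /=.
  by case: eqP => // ->; rewrite prednK.
rewrite big_imset; last by move=> ? ? _ _; exact: h_inj.
apply: eq_big => [m|m _]; first by rewrite inE.
by congr t; apply/funext => j; rewrite ffunE.
Qed.

Lemma mpseries_norm_nondecreasing c v :
  {homo mpseries_norm c v : n m / (n <= m)%N >-> n <= m}.
Proof.
move=> n m nm; rewrite /mpseries_norm -(cube_restrict (fun k => `|mterm c v k|) nm).
rewrite [leRHS](bigID (fun k : {ffun 'I_d -> 'I_m} => [forall i, (k i < n)%N])) /=.
by rewrite lerDl sumr_ge0.
Qed.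

(** The absolute values over a difference of two cubes bound the error made by
    summing over any set of multi-indices between these cubes. *)
Lemma mpseries_sub_le c v N K (P : pred {ffun 'I_d -> 'I_K}) : (N <= K)%N ->
  (forall m : {ffun 'I_d -> 'I_K}, [forall i, (m i < N)%N] -> P m) ->
  `|\sum_(m | P m) mterm c v (fun i => m i) - mpseries c v K| <=
    mpseries_norm c v K - mpseries_norm c v N.
Proof.
move=> NK PN.
have -> : mpseries c v K = \sum_(m | P m) mterm c v (fun i => m i) +
    \sum_(m | ~~ P m) mterm c v (fun i => m i) by rewrite /mpseries (bigID P).
have -> : mpseries_norm c v K = mpseries_norm c v N +
    \sum_(m : {ffun 'I_d -> 'I_K} | ~~ [forall i, (m i < N)%N]) `|mterm c v (fun i => m i)|.
  rewrite /mpseries_norm -(cube_restrict (fun k => `|mterm c v k|) NK).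
  by rewrite (bigID (fun k : {ffun 'I_d -> 'I_K} => [forall i, (k i < N)%N])).
rewrite opprD addNKr normrN addrC addKr.
apply: le_trans (ler_norm_sum _ _ _) _.
rewrite big_mkcond [leRHS]big_mkcond; apply: ler_sum => m _.
have [al|nal] := boolP [forall i, (m i < N)%N]; first by rewrite (PN _ al).
by case: (P m) => /=.
Qed.

(** Adding the series of absolute values makes all terms nonnegative, so
    convergence reduces to that of two bounded monotone sequences. *)
Lemma mpseries_cvg c v B : (forall N, mpseries_norm c v N <= B) ->
  cvgn (mpseries_norm c v) /\ cvgn (mpseries c v).
Proof.
move=> cB.
have cn : cvgn (mpseries_norm c v).
  apply: nondecreasing_is_cvgn; first exact: mpseries_norm_nondecreasing.
  by exists B => _ [N _ <-].
split => //.
pose u N := \sum_(m : {ffun 'I_d -> 'I_N}) (`|mterm c v (fun i => m i)| + mterm c v (fun i => m i)).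
have uE : mpseries c v = fun N => u N - mpseries_norm c v N.
  by apply/funext => N; rewrite /u big_split /= addrAC subrr add0r.
have cu : cvgn u.
  apply: nondecreasing_is_cvgn.
    move=> n m nm; rewrite /u -(cube_restrict (fun k => `|mterm c v k| + mterm c v k) nm).
    rewrite [leRHS](bigID (fun k : {ffun 'I_d -> 'I_m} => [forall i, (k i < n)%N])) /=.
    rewrite lerDl sumr_ge0// => k _; rewrite -lerBlDr sub0r -normrN.
    exact: ler_norm.
  exists (2 * B) => _ [N _ <-]; have := cB N; rewrite /mpseries_norm.
  have : u N <= \sum_(m : {ffun 'I_d -> 'I_N}) (2 * `|mterm c v (fun i => m i)|).
    by apply: ler_sum => m _; have := ler_norm (mterm c v (fun i => m i)); lra.
  rewrite -mulr_sumr; lra.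
by rewrite uE; exact: is_cvgB.
Qed.

Lemma mpseries_norm_le c v w N : (forall i, `|v ord0 i| <= `|w ord0 i|) ->
  mpseries_norm c v N <= mpseries_norm c w N.
Proof.
move=> vw; apply: ler_sum => m _; rewrite !normrM ler_wpM2l// !normr_prod.
by apply: ler_prod => i _; rewrite normr_ge0 !normrX lerXn2r ?nnegrE ?vw.
Qed.

Lemma coord_le_norm v i : `|v ord0 i| <= `|v|.
Proof.
rewrite [leRHS]/Num.Def.normr/= mx_normrE.
exact: (le_bigmax _ (fun ij : 'I_1 * 'I_d => `|v ij.1 ij.2|) (ord0, i)).
Qed.

Lemma nearP_norm p (P : 'rV[R]_d -> Prop) :
  (\forall x \near p, P x) <->
  exists2 e : R, 0 < e & forall x, `|x - p| < e -> P x.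
Proof.
split.
  by move=> /nbhs_ballP[e e0 aP]; exists e => // x xa; apply: aP; rewrite -ball_normE /= distrC.
move=> [e e0 aP]; apply/nbhs_ballP; exists e => // x; rewrite -ball_normE /= distrC.
exact: aP.
Qed.

Lemma norm_const_mx r : 0 <= r -> `|const_mx r : 'rV[R]_d| <= r.
Proof.
move=> r0; rewrite [leLHS]/Num.Def.normr/= mx_normrE.
by apply: bigmax_le => // i _; rewrite mxE ger0_norm.
Qed.

Lemma norm_delta (i : 'I_d) : `|delta_mx ord0 i : 'rV[R]_d| <= 1.
Proof.
rewrite [leLHS]/Num.Def.normr/= mx_normrE; apply: bigmax_le => // j _.
by rewrite mxE; case: (_ && _); rewrite ?normr1 ?normr0.
Qed.

Lemma analytic_series F p : analytic_at F p ->
  exists c r B, [/\ 0 < r, forall N, mpseries_norm c (const_mx r) N <= B &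
    forall v, `|v| <= r -> cvgn (mpseries_norm c v) /\
      mpseries c v @ \oo --> F (p + v)].
Proof.
move=> [c /nearP_norm[e e0 ec]].
have e2 : 0 < e / 2 by rewrite divr_gt0.
have ec' v : `|v| <= e / 2 -> cvgn (mpseries_norm c v) /\
      mpseries c v @ \oo --> F (p + v).
  by move=> ve; have := ec (p + v); rewrite [p + v]addrC addrK; apply; lra.
exists c, (e / 2), (limn (mpseries_norm c (const_mx (e / 2)))); split=> //.
move=> N; apply: nondecreasing_cvgn_le; first exact: mpseries_norm_nondecreasing.
by have [] := ec' _ (norm_const_mx (ltW e2)).
Qed.

End SeveralVar.

(** * Partial derivatives of analytic functions *)

Section Partial.
Variables (R : realType) (d : nat).
Implicit Types (F G : 'rV[R]_d -> R) (p x v w : 'rV[R]_d) (r B : R).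
Implicit Types (c : ('I_d -> nat) -> R) (t : ('I_d -> nat) -> R) (i : 'I_d).

Let rem (a h : R) n := (a + h) ^+ n - a ^+ n - n%:R * a ^+ n.-1 * h.

Let remS (a h : R) n : rem a h n.+1 = (a + h) * rem a h n + n%:R * a ^+ n.-1 * h ^+ 2.
Proof.
rewrite /rem; case: n => [|n] /=; first by rewrite !expr1 !expr0; ring.
by rewrite !exprS -!natr1; ring.
Qed.

(** The remainder is a polynomial in [a] and [h] with nonnegative coefficients, each
    of whose terms has degree at least two in [h].  So for [`|h| <= del] it is at most
    [(h / del) ^ 2] times its value at [`|a|] and [del]. *)
Lemma expr_remainder (a h del : R) n : 0 < del -> `|h| <= del ->
  `|(a + h) ^+ n - a ^+ n - n%:R * a ^+ n.-1 * h| <=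
    (h / del) ^+ 2 * (`|a| + del) ^+ n.
Proof.
move=> d0 hd; rewrite -/(rem a h n).
have key : `|rem a h n| <= (h / del) ^+ 2 * rem `|a| del n.
  elim: n => [|n IH].
    by rewrite /rem !expr0 !subrr !mul0r subrr normr0 mulr0.
  rewrite !remS [leRHS]mulrDr; apply: le_trans (ler_normD _ _) _; apply: lerD.
    rewrite mulrCA normrM ler_pM// (le_trans (ler_normD _ _))// lerD2l//.
  rewrite [leRHS]mulrCA -exprMn divfK ?gt_eqF// !normrM normr_nat normrX.
  by rewrite -expr2 real_normK ?num_real.
apply: le_trans key _; rewrite ler_wpM2l ?sqr_ge0// /rem -addrA gerDl -opprD oppr_le0.
by rewrite addr_ge0 ?exprn_ge0// !mulr_ge0 ?exprn_ge0// ltW.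
Qed.

(** The coefficients of the series differentiated term by term in direction [i]. *)
Definition mpartial i c : ('I_d -> nat) -> R :=
  fun m => (m i).+1%:R * c (shift_idx i m).

Lemma prod_shift (y : 'I_d -> R) i m :
  \prod_j y j ^+ shift_idx i m j = y i * \prod_j y j ^+ m j.
Proof.
rewrite (bigD1 i)//= [in RHS](bigD1 i)//= /shift_idx eqxx exprS -mulrA.
by congr (_ * (_ * _)); apply: eq_bigr => j /negbTE ->.
Qed.

Lemma mpartial_bound i c r B : 0 < r ->
  (forall N, mpseries_norm c (const_mx r) N <= B) ->
  forall N, mpseries_norm (mpartial i c) (const_mx (r / 2)) N <= B / r.
Proof.
move=> r0 cB N; rewrite ler_pdivlMr//.
pose t m := `|mterm c (const_mx r) m|.
apply: le_trans (cB N.+1).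
apply: le_trans (_ : \sum_(m : {ffun 'I_d -> 'I_N}) t (shift_idx i (fun j => m j)) <= _); last first.
  rewrite -cube_shift /mpseries_norm [leRHS](bigID (fun m : {ffun 'I_d -> 'I_N.+1} =>
     (0 < m i)%N && [forall j, (j == i) || (m j < N)%N])) /=.
  by rewrite lerDl sumr_ge0.
rewrite mulr_suml; apply: ler_sum => m _; rewrite /t /mterm /mpartial.
set k := shift_idx i (fun j => m j).
rewrite normrM [leRHS]normrM /mpartial normrM -[X in _ <= _ * `|X|]/(\prod_j _ ^+ k j).
rewrite (_ : (\prod_j (const_mx r : 'rV[R]_d) ord0 j ^+ k j) = r * \prod_j r ^+ m j); last first.
  by rewrite -(prod_shift (fun=> r) i); apply: eq_bigr => j _; rewrite mxE.
have -> : \prod_j (const_mx (r / 2) : 'rV[R]_d) ord0 j ^+ m j = \prod_j (r / 2) ^+ m j.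
  by apply: eq_bigr => j _; rewrite mxE.
have r2 : 0 <= r / 2 by rewrite divr_ge0// ltW.
have P1 : 0 <= \prod_j (r / 2) ^+ m j by apply: prodr_ge0 => j _; exact: exprn_ge0.
have P2 : 0 <= \prod_j r ^+ m j by apply: prodr_ge0 => j _; rewrite exprn_ge0// ltW.
rewrite normr_nat (ger0_norm P1) (ger0_norm (mulr_ge0 (ltW r0) P2)).
rewrite [_ * `|c k|]mulrC -!mulrA ler_wpM2l// mulrA [leRHS]mulrC ler_wpM2r ?(ltW r0)//.
rewrite (bigD1 i)//= [leRHS](bigD1 i)//= mulrA ler_pM//.
- by rewrite mulr_ge0// exprn_ge0.
- by rewrite prodr_ge0// => j _; rewrite exprn_ge0.
- rewrite expr_div_n mulrCA ler_piMr ?exprn_ge0 ?(ltW r0)//.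
  by rewrite ler_pdivrMr ?exprn_gt0// mul1r -natrX ler_nat succ_le_exp2.
- apply: ler_prod => j _; rewrite exprn_ge0//= lerXn2r// ?nnegrE ?(ltW r0)//.
  by rewrite ler_pdivrMr//; move: r0; lra.
Qed.

Lemma is_derive_quadratic F x e (A K del : R) : 0 < del ->
  (forall h : R, `|h| <= del -> `|F (x + h *: e) - F x - h * A| <= K * h ^+ 2) ->
  is_derive x e F A.
Proof.
move=> del0 FK.
have K0 : 0 <= K.
  have := le_trans (normr_ge0 _) (FK del _); rewrite pmulr_lge0 ?exprn_gt0//.
  by apply; rewrite ger0_norm// ltW.
have cv : h^-1 *: ((F \o shift x) (h *: e) - F x) @[h --> 0^'] --> A.
  apply/cvgrPdist_le => eps eps0; near=> h.
  have h0 : h != 0 by near: h; exact: nbhs_dnbhs_neq.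
  have hd : `|h| <= del by near: h; exact: dnbhs0_le.
  have hK : `|h| <= eps / (K + 1) by near: h; apply: dnbhs0_le; rewrite divr_gt0// ltr_wpDl.
  have E : A - h^-1 *: ((F \o shift x) (h *: e) - F x) =
     - (h^-1 * (F (x + h *: e) - F x - h * A)).
    by rewrite /= /shift /= addrC (addrC _ x) /GRing.scale /=; field.
  rewrite E normrN normrM normfV ler_pdivrMl ?normr_gt0//.
  apply: le_trans (FK _ hd) _.
  rewrite -(ger0_norm (sqr_ge0 h)) normrX expr2 mulrCA ler_wpM2l//.
  move: hK; rewrite ler_pdivlMr ?ltr_wpDl// => hK.
  by apply: le_trans hK; rewrite mulrC ler_wpM2l//; lra.
have dF : derivable F x e by apply/cvg_ex; exists A.
by apply: DeriveDef => //; exact/cvg_lim.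
Unshelve. all: by end_near. Qed.

(** Term-by-term differentiation in direction [i] turns a cube of multi-indices
    into a box that is longer by one in direction [i]; the sums over these boxes
    are squeezed between those over two consecutive cubes. *)
Lemma cvg_mpseries_slabs c w F p i : cvgn (mpseries_norm c w) ->
  mpseries c w @ \oo --> F (p + w) ->
  (fun N => \sum_(m : {ffun 'I_d -> 'I_N.+1} | [forall j, (j == i) || (m j < N)%N])
     mterm c w (fun j => m j)) @ \oo --> F (p + w).
Proof.
move=> cn cF.
have cF' : mpseries c w N.+1 @[N --> \oo] --> F (p + w) by rewrite (cvg_shiftS (mpseries c w)).
rewrite -[F _]addr0; set S := fun N => _.
have -> : S = (fun N => mpseries c w N.+1 + (S N - mpseries c w N.+1)).
  by apply/funext => N; rewrite subrKC.
apply: cvgD => //.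
have gap : mpseries_norm c w N.+1 - mpseries_norm c w N @[N --> \oo] --> 0.
  rewrite -[X in _ --> X](subrr (limn (mpseries_norm c w))).
  by apply: cvgB => //; rewrite (cvg_shiftS (mpseries_norm c w)).
apply/cvgr0Pnorm_lt => eps eps0; have /cvgr0Pnorm_lt/(_ eps eps0) := gap.
apply: filterS => N; apply: le_lt_trans; apply: le_trans (ler_norm _).
apply: mpseries_sub_le => // m /forallP mN; apply/forallP => j.
by rewrite mN orbT.
Qed.

(** The first-order remainder of every partial sum is bounded by a constant times
    [h ^ 2], uniformly in the partial sum, so the bound passes to the limit. *)
Lemma partial_series c r B F p i v : 0 < r ->
  (forall N, mpseries_norm c (const_mx r) N <= B) ->
  (forall v, `|v| <= r -> cvgn (mpseries_norm c v) /\
      mpseries c v @ \oo --> F (p + v)) ->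
  `|v| <= r / 2 ->
  is_derive (p + v) (delta_mx ord0 i) F (limn (mpseries (mpartial i c) v)).
Proof.
move=> r0 cB cF vr; have r2 : 0 < r / 2 by rewrite divr_gt0.
have norm_const : `|r / 2| = r / 2 by rewrite ger0_norm// ltW.
have vj j : `|v ord0 j| <= r / 2 by apply: le_trans (coord_le_norm _ _) vr.
have [_ cA] : cvgn (mpseries_norm (mpartial i c) v) /\ cvgn (mpseries (mpartial i c) v).
  apply: (@mpseries_cvg _ _ _ _ (B / r)) => N.
  apply: le_trans (mpartial_bound i r0 cB N); apply: mpseries_norm_le => j.
  by rewrite mxE norm_const.
apply: (@is_derive_quadratic _ _ _ _ (B / (r / 2) ^+ 2) (r / 2)) => // h hr.
set w := v + h *: delta_mx ord0 i.
have wE j : w ord0 j = v ord0 j + (if j == i then h else 0).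
  by rewrite !mxE eqxx /=; case: eqP; rewrite ?mulr1 ?mulr0.
have wr : `|w| <= r.
  apply: le_trans (ler_normD _ _) _; rewrite normrZ.
  have := ler_pM (normr_ge0 h) (normr_ge0 _) hr (norm_delta R i); lra.
have [vn vF] : cvgn (mpseries_norm c v) /\ mpseries c v @ \oo --> F (p + v).
  by apply: cF; apply: le_trans vr _; lra.
have [wn wF] := cF w wr.
have lim_est : (fun N =>
    \sum_(m : {ffun 'I_d -> 'I_N.+1} | [forall j, (j == i) || (m j < N)%N])
      mterm c w (fun j => m j) -
    \sum_(m : {ffun 'I_d -> 'I_N.+1} | [forall j, (j == i) || (m j < N)%N])
      mterm c v (fun j => m j) - h * mpseries (mpartial i c) v N) @ \oo -->
   F (p + w) - F (p + v) - h * limn (mpseries (mpartial i c) v).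
  apply: cvgB; last exact: cvgMl_tmp.
  by apply: cvgB; apply: cvg_mpseries_slabs.
rewrite -(addrA p) -/w.
have /cvg_norm/cvgr_to_le := lim_est; apply; exists 0%N => // N _ /=.
pose T m := c m * ((m i)%:R * v ord0 i ^+ (m i).-1 * \prod_(j | j != i) v ord0 j ^+ m j).
have -> : mpseries (mpartial i c) v N = \sum_(m : {ffun 'I_d -> 'I_N.+1} |
    [forall j, (j == i) || (m j < N)%N]) T (fun j => m j).
  rewrite [RHS](bigID (fun m : {ffun 'I_d -> 'I_N.+1} => 0 < m i)%N) /=.
  rewrite [X in _ = _ + X]big1 ?addr0; last first.
    by move=> m /andP[_]; rewrite -eqn0Ngt => /eqP m0; rewrite /T m0 !mul0r mulr0.
  under [RHS]eq_bigl do rewrite andbC.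
  rewrite cube_shift; apply: eq_bigr => m _.
  have si : shift_idx i (fun j => m j) i = (m i).+1 by rewrite /shift_idx eqxx.
  rewrite /mterm /mpartial /T si (bigD1 i)//=.
  rewrite [in RHS](eq_bigr (fun j => v ord0 j ^+ m j)); first by ring.
  by move=> j /negbTE ji; rewrite /shift_idx ji.
rewrite mulr_sumr -!sumrB; apply: le_trans (ler_norm_sum _ _ _) _.
rewrite -mulrA (mulrC _ (h ^+ 2)) -expr_div_n mulrC.
apply: le_trans (ler_wpM2l (sqr_ge0 _) (cB N.+1)).
rewrite /mpseries_norm mulr_sumr.
rewrite [leRHS](bigID (fun m : {ffun 'I_d -> 'I_N.+1} => [forall j, (j == i) || (m j < N)%N])) /=.
apply: le_trans (_ : _ <= \sum_(m : {ffun 'I_d -> 'I_N.+1} | [forall j, (j == i) || (m j < N)%N])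
     ((h / (r / 2)) ^+ 2 * `|mterm c (const_mx r) (fun j => m j)|)) _; last first.
  by rewrite lerDl sumr_ge0// => m _; rewrite mulr_ge0// sqr_ge0.
apply: ler_sum => m _; set k := fun j => nat_of_ord (m j).
have -> : mterm c w k - mterm c v k - h * T k =
  c k * (\prod_(j | j != i) v ord0 j ^+ k j) *
   ((v ord0 i + h) ^+ k i - v ord0 i ^+ k i - (k i)%:R * v ord0 i ^+ (k i).-1 * h).
  rewrite /mterm (bigD1 i)//= [\prod_j v ord0 j ^+ k j](bigD1 i)//= wE eqxx.
  rewrite (eq_bigr (fun j => v ord0 j ^+ k j)); last first.
    by move=> j /negbTE ji; rewrite wE ji addr0.
  by rewrite /T; ring.
rewrite normrM; have := @expr_remainder (v ord0 i) h (r / 2) (k i) r2 hr.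
move=> /(ler_wpM2l (normr_ge0 (c k * (\prod_(j | j != i) v ord0 j ^+ k j)))) /le_trans; apply.
rewrite mulrCA ler_wpM2l ?sqr_ge0// /mterm !normrM -mulrA ler_wpM2l//.
rewrite !normr_prod [leRHS](bigD1 i)//= mulrC ler_pM//.
- by rewrite exprn_ge0// addr_ge0// ltW.
- by apply: prodr_ge0.
- rewrite mxE normrX (ger0_norm (ltW r0)) lerXn2r// ?nnegrE ?addr_ge0 ?(ltW r0) ?(ltW r2)//.
  by have := vj i; lra.
- apply: ler_prod => j _; rewrite normr_ge0 !normrX mxE (ger0_norm (ltW r0)).
  by rewrite lerXn2r// ?nnegrE ?(ltW r0)//; have := vj j; lra.
Qed.

Lemma analytic_partial F p i : analytic_at F p ->
  analytic_at (partial i F) p.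
Proof.
move=> /analytic_series[c [r [B [r0 cB cF]]]].
exists (mpartial i c); apply/nearP_norm; exists (r / 2); first by rewrite divr_gt0.
move=> x xr; set v := x - p.
have [|n1 n2] := @mpseries_cvg _ _ (mpartial i c) v (B / r).
  move=> N; apply: le_trans (mpartial_bound i r0 cB N); apply: mpseries_norm_le => j.
  rewrite [const_mx _ _ _]mxE (@ger0_norm _ (r / 2)); last by rewrite divr_ge0// ltW.
  exact: le_trans (coord_le_norm _ _) (ltW xr).
split=> //; have := partial_series i r0 cB cF (ltW xr).
by rewrite -/v /v subrKC => -[_]; rewrite /partial => ->.
Qed.

End Partial.

(** * Differentiability and the chain rule *)

Section Chain.
Variables (R : realType) (d : nat).
Implicit Types (F G : 'rV[R]_d -> R) (p x v w : 'rV[R]_d) (r B : R).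
Implicit Types (c : ('I_d -> nat) -> R) (i : 'I_d).

Lemma differentiable_quadratic F p (K del : R) : 0 < del ->
  (forall v, `|v| <= del -> `|F (p + v)| <= K * `|v| ^+ 2) -> differentiable F p.
Proof.
move=> del0 FK.
have Fp : F p = 0.
  have := FK 0; rewrite normr0 addr0 expr0n mulr0 normr_le0 => /(_ (ltW del0)).
  by move/eqP.
have E : F \o shift p = cst (F p) + 0 +o_ (0 : 'rV[R]_d) id.
  apply/eqaddoP => _/posnumP[eps].
  have K1 : 0 < `|K| + 1 by rewrite ltr_wpDl.
  near=> v; rewrite /= Fp !fctE /= addr0 subr0 addrC.
  have vd : `|v| <= del.
    near: v; apply/nearP_norm; exists del => // v; rewrite subr0; exact: ltW.
  have vK : `|v| <= eps%:num / (`|K| + 1).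
    near: v; apply/nearP_norm; exists (eps%:num / (`|K| + 1)); first by rewrite divr_gt0.
    by move=> v; rewrite subr0; exact: ltW.
  apply: le_trans (FK _ vd) _; rewrite expr2 mulrA ler_wpM2r//.
  apply: le_trans (_ : (`|K| + 1) * `|v| <= _).
    by rewrite ler_wpM2r// (le_trans (ler_norm _))// lerDl.
  by rewrite mulrC -ler_pdivlMr.
have dE : 'd F p = 0 :> ('rV[R]_d -> R).
  by apply/diff_unique => //; exact: cst_continuous.
apply/diff_locallyP; rewrite dE; split => //; exact: cst_continuous.
Unshelve. all: by end_near. Qed.

Lemma differentiable_mpseries c p N : differentiable (mpseries c ^~ N) p.
Proof.
have prodP (m : 'I_d -> nat) (s : seq 'I_d) :
    differentiable (fun v : 'rV[R]_d => \prod_(i <- s) v ord0 i ^+ m i : R) p.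
  elim: s => [|i s IH].
    rewrite (_ : (fun _ => _) = cst (1 : R)); first exact: differentiable_cst.
    by apply/funext => v; rewrite big_nil.
  rewrite (_ : (fun _ => _) = (fun v : 'rV[R]_d => v ord0 i : R) ^+ m i *
    (fun v : 'rV[R]_d => \prod_(i <- s) v ord0 i ^+ m i : R)).
    apply: differentiableM => //; case: (m i) => [|k].
      by rewrite expr0; exact: (differentiable_cst (1 : R)).
    by apply: differentiableX; exact: differentiable_coord.
  by apply/funext => v; rewrite big_cons fctE exprfctE.
rewrite /mpseries; elim: (index_enum _) => [|m s IH].
  rewrite (_ : (fun _ => _) = cst (0 : R)); first exact: differentiable_cst.
  by apply/funext => v; rewrite big_nil.
rewrite (_ : (fun _ => _) = (fun v : 'rV[R]_d => mterm c v (fun i => m i)) +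
    (fun v : 'rV[R]_d => \sum_(m <- s) mterm c v (fun i => m i))).
  apply: differentiableD => //.
  apply: (differentiableM (differentiable_cst (c (fun i => m i)) p)).
  exact: prodP.
by apply/funext => v; rewrite big_cons.
Qed.

(** Outside the cube of side 2, every multi-index has an entry at least 2, so the
    corresponding terms are quadratically small at the centre of the expansion;
    the remaining terms form a polynomial. *)
Lemma analytic_differentiable F p : analytic_at F p -> differentiable F p.
Proof.
move=> /analytic_series[c [r [B [r0 cB cF]]]].
pose P x := mpseries c (x - p) 2.
have dP : differentiable P p.
  rewrite (_ : P = (mpseries c ^~ 2) \o (fun x => x - p)) //.
  apply: differentiable_comp; last exact: differentiable_mpseries.
  exact: differentiableB.
have -> : F = P + (F - P) by apply/funext => x; rewrite !fctE subrKC.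
apply: differentiableD => //.
apply: (@differentiable_quadratic _ _ (B / r ^+ 2) r) => // v vr.
rewrite !fctE /P addrC (addrC p) addrK addrC.
have [vn vF] := cF v vr.
have /cvg_norm/cvgr_to_le : (fun N => mpseries c v N - mpseries c v 2) @ \oo --> F (p + v) - mpseries c v 2.
  by apply: cvgB => //; exact: cvg_cst.
rewrite (addrC v p); apply; exists 2%N => // N /= N2.
rewrite /mpseries -(cube_restrict (mterm c v) N2).
rewrite (bigID (fun k : {ffun 'I_d -> 'I_N} => [forall i, (k i < 2)%N])) /= addrC addrK.
apply: le_trans (ler_norm_sum _ _ _) _.
rewrite -mulrA [_^-1 * _]mulrC -expr_div_n mulrC.
apply: le_trans (ler_wpM2l (sqr_ge0 _) (cB N)).
rewrite /mpseries_norm mulr_sumr big_mkcond; apply: ler_sum => m _.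
have q0 : 0 <= `|v| / r by rewrite divr_ge0// ltW.
case: ifPn => [|_]; last by rewrite mulr_ge0// sqr_ge0.
rewrite negb_forall => /existsP[i]; rewrite -leqNgt => mi.
rewrite /mterm !normrM mulrCA ler_wpM2l// !normr_prod.
apply: le_trans (_ : \prod_(j < d) ((`|v| / r) ^+ m j * r ^+ m j) <= _).
  apply: ler_prod => j _; rewrite normr_ge0 normrX -exprMn divfK ?gt_eqF//.
  by rewrite lerXn2r ?nnegrE// coord_le_norm.
rewrite big_split /= ler_pM//.
- by apply: prodr_ge0 => j _; rewrite exprn_ge0.
- by apply: prodr_ge0 => j _; rewrite exprn_ge0// ltW.
- have q1 : `|v| / r <= 1 by rewrite ler_pdivrMr// mul1r.
  rewrite (bigD1 i)//= -[leRHS]mulr1 ler_pM//.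
  + exact: exprn_ge0.
  + by apply: prodr_ge0 => j _; rewrite exprn_ge0.
  + exact: ler_wiXn2l.
  + by apply: prodr_ile1 => j _; rewrite exprn_ge0//= exprn_ile1.
- by apply: ler_prod => j _; rewrite exprn_ge0 ?(ltW r0)//= mxE normrX ger0_norm ?(ltW r0).
Qed.

Lemma chain_rule F (gam : R -> 'rV[R]_d) (t : R) (gam' : 'I_d -> R) :
  differentiable F (gam t) ->
  (forall j, is_derive t (1 : R) (fun s => gam s ord0 j) (gam' j)) ->
  is_derive t (1 : R) (F \o gam) (\sum_j gam' j * partial j F (gam t)).
Proof.
move=> dF dg.
have dgam : derivable gam t 1.
  by apply/derivable_mxP => i j; rewrite (ord1 i); have [] := dg j.
have dgam' := (derivable1_diffP _ _).1 dgam.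
have dFg : differentiable (F \o gam) t by exact: differentiable_comp.
apply: DeriveDef; first exact: diff_derivable.
rewrite deriveE// diff_comp//= -(deriveE (1 : R) dgam') derive_mx//.
have -> : \matrix_(i, j) 'D_1 (fun t => gam t i j) t = \sum_j gam' j *: delta_mx ord0 j :> 'rV[R]_d.
  apply/rowP => j; rewrite mxE summxE (bigD1 j)//= big1 ?addr0.
    by have [_ ->] := dg j; rewrite !mxE !eqxx mulr1.
  by move=> k kj; rewrite !mxE eqxx /= eq_sym (negbTE kj) mulr0.
rewrite linear_sum; apply: eq_bigr => j _.
by rewrite linearZ /partial deriveE.
Qed.

End Chain.

(** * Zero sets along which all partial derivatives agree *)

Section Flat.
Variables (R : realType) (d : nat).
Implicit Types (y v z : 'rV[R]_d).

Lemma is_derive0_le (f : R -> R) (a k : R) : is_derive a (1 : R) f 0 -> 0 < k ->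
  exists2 e : R, 0 < e & forall h, `|h| < e -> `|f (a + h) - f a| <= k * `|h|.
Proof.
move=> [df f0] k0; have cf : h^-1 *: ((f \o shift a) (h *: (1 : R)) - f a) @[h --> 0^'] --> (0 : R).
  by rewrite -[X in _ --> X]f0; exact: df.
have /cvgr0Pnorm_le/(_ k k0) := cf.
move=> /nbhs_ballP[e e0 eP]; exists e => // h he.
have [->|h0] := eqVneq h 0; first by rewrite addr0 subrr !normr0 mulr0.
have := eP h; rewrite -ball_normE /= sub0r normrN => /(_ he h0).
rewrite /shift /= /GRing.scale /= mulr1 normrM normfV (addrC h).
by rewrite ler_pdivrMl ?normr_gt0// mulrC.
Qed.

Lemma le_is_derive0 (f : R -> R) (a : R) :
  (forall k, 0 < k -> exists2 e : R, 0 < e &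
     forall h, `|h| < e -> `|f (a + h) - f a| <= k * `|h|) ->
  is_derive a (1 : R) f 0.
Proof.
move=> H; have cf : h^-1 *: ((f \o shift a) (h *: (1 : R)) - f a) @[h --> 0^'] --> (0 : R).
  apply/cvgr0Pnorm_le => k /H[e e0 eP].
  apply/nbhs_ballP; exists e => // h; rewrite -ball_normE /= sub0r normrN => he h0.
  rewrite /shift /= /GRing.scale /= mulr1 normrM normfV (addrC h).
  by rewrite ler_pdivrMl ?normr_gt0// mulrC; exact: eP.
have dF : derivable f a 1 by apply/cvg_ex; exists 0.
by apply: DeriveDef => //; exact/cvg_lim.
Qed.

(** Let [y] lie in the hyperplane [\sum_j y j = 0].  As [Psi] increases strictly in
    direction [i0], each line [t *: y + s *: e] contains exactly one zero, at
    [s = s t].  Along [y] the derivative of [Psi] vanishes at this zero, while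
    [Psi] grows at rate at least [m] in [s]; hence [s] has derivative 0, and
    [s 1 = s 0 = 0], so that [y] is a zero.  A zero off the hyperplane would lie
    on the same line in direction [i0] as a point of the hyperplane, which is a
    zero as well. *)
Lemma flat_zero_set (Psi : 'rV[R]_d -> R) (i0 : 'I_d) (eps m : R) :
  0 < eps -> 0 < m -> Psi 0 = 0 ->
  (forall y, `|y| < eps -> {for y, continuous Psi}) ->
  (forall y, `|y| < eps -> exists2 D, m <= D &
     is_derive (0 : R) (1 : R) (fun t : R => Psi (y + t *: delta_mx ord0 i0)) D) ->
  (forall y v, `|y| < eps -> Psi y = 0 -> \sum_j v ord0 j = 0 ->
     is_derive (0 : R) (1 : R) (fun t : R => Psi (y + t *: v)) 0) ->
  exists2 eta : R, 0 < eta & forall y, `|y| < eta ->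
    (Psi y = 0 <-> \sum_j y ord0 j = 0).
Proof.
move=> eps0 m0 Psi0 Pc PB PA.
pose e : 'rV[R]_d := delta_mx ord0 i0.
have ne (s : R) : `|s *: e| <= `|s|.
  by rewrite normrZ ler_piMr// norm_delta.
have lineD y (s : R) : `|y + s *: e| < eps -> exists2 D, m <= D &
    is_derive s (1 : R) (fun t : R => Psi (y + t *: e)) D.
  move=> /PB[D mD dD]; exists D => //.
  have ds : is_derive s (1 : R) (fun t : R => t - s : R) (1 : R).
    by apply: is_derive_eq; rewrite oppr0 addr0.
  have dD' : is_derive (s - s) (1 : R) (fun t : R => Psi (y + s *: e + t *: e)) D.
    by rewrite subrr.
  have := @is_derive1_comp _ (fun t : R => Psi (y + s *: e + t *: e)) (fun t => t - s) s _ _ dD' ds; rewrite mulr1.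
  rewrite (_ : _ \o _ = fun t : R => Psi (y + t *: e))//.
  by apply/funext => t /=; rewrite -addrA -scalerDl subrKC.
have lineC y (s : R) : `|y + s *: e| < eps -> {for s, continuous (fun t : R => Psi (y + t *: e))}.
  by move=> /lineD[D _ [dd _]]; exact/differentiable_continuous/derivable1_diffP.
have mono y (s1 s2 : R) : s1 <= s2 ->
    (forall s, s1 <= s <= s2 -> `|y + s *: e| < eps) ->
    m * (s2 - s1) <= Psi (y + s2 *: e) - Psi (y + s1 *: e).
  move=> s12 sin; pose df s := 'D_1 (fun t : R => Psi (y + t *: e)) s.
  have dfm s : s1 <= s <= s2 -> m <= df s /\ is_derive s (1 : R) (fun t : R => Psi (y + t *: e)) (df s).
    move=> /sin/lineD[D mD dD]; have [d1 d2] := dD; rewrite /df.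
    by split; [rewrite d2|exact: derivableP].
  have [||s ss ->] := @MVT_segment _ (fun t : R => Psi (y + t *: e)) df s1 s2 s12.
  - by move=> s; rewrite in_itv /= => /andP[? ?]; apply: (proj2 (dfm _ _)); rewrite !ltW.
  - apply: derivable_within_continuous => s; rewrite in_itv /= => ss.
    by have [_ []] := dfm _ ss.
  - by rewrite ler_wpM2r ?subr_ge0//; apply: (proj1 (dfm _ _)); move: ss; rewrite in_itv.
have mono_abs y (s1 s2 : R) :
    (forall s, `|s| <= Num.max `|s1| `|s2| -> `|y + s *: e| < eps) ->
    m * `|s2 - s1| <= `|Psi (y + s2 *: e) - Psi (y + s1 *: e)|.
  have main (u1 u2 : R) : u1 <= u2 -> (forall s, `|s| <= Num.max `|u1| `|u2| -> `|y + s *: e| < eps) ->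
    m * `|u2 - u1| <= `|Psi (y + u2 *: e) - Psi (y + u1 *: e)|.
    move=> u12 uin; rewrite ger0_norm ?subr_ge0//; apply: le_trans (ler_norm _).
    apply: mono => // s /andP[us su]; apply: uin.
    rewrite le_max !ler_norml; apply/orP.
    have [s0|s0] := leP 0 s; [right|left]; apply/andP.
      have := ler_norm u2; lra.
    have := ler_norm (- u1); rewrite normrN; lra.
  move=> sin; have [s12|s21] := leP s1 s2; first exact: main.
  by rewrite distrC [leRHS]distrC; apply: main (ltW s21) _; rewrite maxC.
pose del := eps / 2.
have del0 : 0 < del by rewrite divr_gt0.
have small y (s : R) : `|y| < eps / 2 -> `|s| <= del -> `|y + s *: e| < eps.
  by move=> yr sr; apply: le_lt_trans (ler_normD _ _) _; have := ne s; rewrite /del in sr; lra.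
have del_eps (s : R) : `|s| <= del -> `|s *: e| < eps.
  by move=> sd; have := @small 0 s; rewrite normr0 add0r; apply => //; rewrite divr_gt0.
have [eta1 eta10 [eta1eps top bot]] : exists2 eta1 : R, 0 < eta1 & [/\ eta1 <= eps / 2,
    forall y, `|y| < eta1 -> 0 < Psi (y + del *: e) &
    forall y, `|y| < eta1 -> Psi (y - del *: e) < 0].
  have nd : `|del| <= del by rewrite ger0_norm// ltW.
  have nd' : `|- del| <= del by rewrite normrN.
  have mono0 := @mono 0.
  have P1 : 0 < Psi (del *: e).
    have := @mono0 0 del (ltW del0); rewrite !add0r scale0r Psi0 !subr0 => H.
    apply: lt_le_trans (H _); first exact: mulr_gt0.
    move=> s /andP[s0 sd]; rewrite add0r; apply: del_eps.
    by rewrite ger0_norm.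
  have P2 : Psi (- del *: e) < 0.
    have := @mono0 (- del) 0; rewrite oppr_le0 (ltW del0) => /(_ isT).
    rewrite !add0r scale0r Psi0 !sub0r opprK -oppr_gt0 => H.
    apply: lt_le_trans (H _); first exact: mulr_gt0.
    move=> s /andP[s0 sd]; rewrite add0r; apply: del_eps.
    by rewrite ler0_norm//; lra.
  have /nearP_norm[r1 r10 r1P] : \forall z \near del *: e, 0 < Psi z.
    exact: (cvgr_gt _ (Pc _ (del_eps _ nd))).
  have /nearP_norm[r2 r20 r2P] : \forall z \near - del *: e, Psi z < 0.
    exact: (cvgr_lt _ (Pc _ (del_eps _ nd'))).
  exists (Num.min (eps / 2) (Num.min r1 r2)); first by rewrite !lt_min r10 r20 divr_gt0.
  split; first by rewrite ge_min lexx.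
    by move=> y; rewrite !lt_min => /and3P[_ y1 _]; apply: r1P; rewrite addrK.
  by move=> y; rewrite !lt_min => /and3P[_ _ y2]; apply: r2P; rewrite scaleNr addrK.
have key y : `|y| < eta1 -> \sum_j y ord0 j = 0 -> Psi y = 0.
  have [->//|y0] := eqVneq y 0.
  move=> yeta sy0.
  have yn : 0 < `|y| by rewrite normr_gt0.
  (* The segment from 0 to [y] is prolonged beyond both ends, so that [s] is
     differentiable at 0 and 1. *)
  pose T := eta1 / `|y|.
  have T1 : 1 < T by rewrite ltr_pdivlMr// mul1r.
  have tin (t : R) : `|t| < T -> `|t *: y| < eta1.
    by move=> tT; rewrite normrZ -ltr_pdivlMr.
  have tin' (t : R) : `|t| < T -> `|t *: y| < eps / 2.
    by move=> /tin tt; exact: lt_le_trans tt eta1eps.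
  have : forall t : R, exists s : R, `|t| < T -> `|s| <= del /\ Psi (t *: y + s *: e) = 0.
    move=> t; have [tT|] := boolP (`|t| < T); last by exists 0.
    have [|||s sdel s0] := @IVT _ (fun s : R => Psi (t *: y + s *: e)) (- del) del 0.
    - by rewrite ge0_cp// ltW.
    - apply: derivable_within_continuous => s; rewrite in_itv /= -ler_norml => sd.
      by have [D _ [dd _]] := lineD _ _ (small _ _ (tin' _ tT) sd).
    - rewrite scaleNr ge_min le_max (ltW (top _ (tin _ tT))) (ltW (bot _ (tin _ tT))).
      by rewrite orbT.
    - by exists s => _; split => //; move: sdel; rewrite in_itv /= -ler_norml.
  move=> /choice[s sP].
  have ds t : `|t - 0| < T -> is_derive t (1 : R) s 0.
    rewrite subr0 => tT; apply: le_is_derive0 => k k0.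
    have [sd s0] := sP _ tT.
    have dz := PA _ y (small _ _ (tin' _ tT) sd) s0 sy0.
    have [r r0 rP] := is_derive0_le dz (mulr_gt0 m0 k0).
    exists (Num.min r (T - `|t|)); first by rewrite lt_min r0 subr_gt0.
    move=> h; rewrite lt_min => /andP[hr hT].
    have thT : `|t + h| < T by apply: le_lt_trans (ler_normD _ _) _; lra.
    have [sd' s0'] := sP _ thT.
    have := rP _ hr; rewrite scale0r add0r addr0 s0 subr0 => est.
    rewrite -(ler_pM2l m0) mulrA; apply: le_trans est.
    have := @mono_abs ((t + h) *: y) (s t) (s (t + h)).
    rewrite s0' sub0r normrN => H.
    rewrite -(addrAC (t *: y)) -scalerDl; apply: H => u uM.
    apply: small; first exact: tin'.
    by apply: le_trans uM _; rewrite ge_max sd.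
  have T0 : 0 < T by apply: lt_trans T1.
  have T0' : `|(0 : R)| < T by rewrite normr0.
  have [s0d sz] := sP 0 T0'.
  have T1' : `|(1 : R)| < T by rewrite normr1.
  have [s1d s1z] := sP 1 T1'.
  have s10 : s 1 = s 0 by apply: (derive0_const ds); rewrite subr0.
  have s00 : s 0 = 0.
    have := @mono_abs 0 0 (s 0); rewrite add0r scale0r addr0 Psi0 subr0.
    rewrite scale0r add0r in sz; rewrite sz subrr normr0 => H.
    have : m * `|s 0| <= 0.
      apply: H => u uM; rewrite add0r; apply: del_eps; apply: le_trans uM _.
      by rewrite ge_max s0d ltW.
    by rewrite pmulr_rle0// normr_le0 => /eqP.
  by move: s1z; rewrite s10 s00 scale0r scale1r addr0.
have d1 : 0 < d.+1%:R :> R by rewrite ltr0n.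
(* The projection of [y] to the hyperplane along direction [i0] moves it by at
   most [d * `|y|]. *)
exists (eta1 / d.+1%:R) => [|y yr]; first exact: divr_gt0.
have yn0 := normr_ge0 y.
have ysmall : (1 + d%:R) * `|y| < eta1 by rewrite mulrC nat1r -ltr_pdivlMr.
have dn : 0 <= d%:R * `|y| by rewrite mulr_ge0.
have yeta1 : `|y| < eta1 by lra.
split; last exact: key.
move=> Py; set sig := \sum_j y ord0 j.
have sigd : `|sig| <= d%:R * `|y|.
  apply: le_trans (ler_norm_sum _ _ _) _.
  rewrite -[X in X%:R * _](card_ord d) mulr_natl -sumr_const.
  by apply: ler_sum => j _; exact: coord_le_norm.
have y'0 : Psi (y + - sig *: e) = 0.
  apply: key.
    by apply: le_lt_trans (ler_normD _ _) _; have := ne (- sig); rewrite normrN; lra.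
  under eq_bigr do rewrite !mxE eqxx /=.
  rewrite big_split /= -/sig (bigD1 i0)//= eqxx mulr1 big1 ?addr0 ?subrr//.
  by move=> j /negbTE ->; rewrite mulr0.
have := @mono_abs y 0 (- sig); rewrite scale0r addr0 Py y'0 subrr normr0 subr0 normrN => H.
have : m * `|sig| <= 0.
  apply: H => u uM.
  have {uM} us : `|u| <= `|sig| by apply: le_trans uM _; rewrite ge_max lexx normr_ge0.
  by apply: le_lt_trans (ler_normD _ _) _; have := ne u; lra.
by rewrite pmulr_rle0// normr_le0 => /eqP.
Qed.

End Flat.

(** * From degeneracy to the factorization *)

Section Forward.
Variables (R : realType) (d : nat).
Implicit Types (F G : 'rV[R]_d -> R) (p x y v : 'rV[R]_d) (Omega : set 'rV[R]_d).

Lemma open_box (I : 'I_d -> set R) : (forall i, open (I i)) -> open (box I).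
Proof.
move=> Io; rewrite openE => x Ix; rewrite /interior.
have H i : \forall y \near (x : 'rV[R]_d), I i ((y : 'rV[R]_d) ord0 i).
  have c : {for (x : 'rV[R]_d), continuous (fun y : 'rV[R]_d => y ord0 i)}.
    exact/differentiable_continuous/differentiable_coord.
  exact: (c _ (open_nbhs_nbhs (conj (Io i) (Ix i)))).
exact: (@filter_forall _ _ (fun i (y : 'rV[R]_d) => I i (y ord0 i)) (nbhs (x : 'rV[R]_d)) _ H).
Qed.

Lemma analytic_iso_inverse (f : R -> R) (I J : set R) : open J ->
  analytic_iso f I J -> exists g : R -> R,
  [/\ forall s, I s -> g (f s) = s,
      forall z, J z -> I (g z) /\ f (g z) = z &
      forall s, I s -> derive1 f s != 0 /\
        is_derive (f s) (1 : R) g (derive1 f s)^-1].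
Proof.
move=> Jo [fan [fJ _ surj] [g [gK gan]]]; exists g.
have fK z : J z -> I (g z) /\ f (g z) = z.
  by move=> /surj[s Is <-]; rewrite gK.
split=> // s Is; have Js := fJ _ Is.
apply: (@is_derive_local_inverse _ f).
- by rewrite gK.
- by apply: filterS (open_nbhs_nbhs (conj Jo Js)) => z /fK[].
- exact: (nbhs_singleton (analytic1_derivable (gan _ Js))).
- rewrite gK// derive1E; apply: derivableP.
  exact: (nbhs_singleton (analytic1_derivable (fan _ Is))).
Qed.

(** Moving the coordinates [i0] and [i] of a point against each other keeps
    [\sum_j f j] equal to zero, so the point stays in the zero set of [F] and the
    derivative of [F] along this curve vanishes. *)
Lemma degenerate_parallel F I J (f : 'I_d -> R -> R) i0 i x :
  analytic_at F x ->
  (forall i, open (I i)) -> open J ->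
  (forall i, analytic_iso (f i) (I i) J) ->
  (forall x, box I x -> (F x = 0 <-> \sum_(i < d) f i (x ord0 i) = 0)) ->
  box I x -> F x = 0 -> i != i0 ->
  partial i F x * derive1 (f i0) (x ord0 i0) =
  partial i0 F x * derive1 (f i) (x ord0 i).
Proof.
move=> Fx Io Jo fiso FE Ix Fx0 ii0.
have [_ [fun0 _ _] _] := fiso i0.
have [fani _ _] := fiso i.
have [g [gK fK gD]] := analytic_iso_inverse Jo (fiso i0).
set s0 := x ord0 i0; set si := x ord0 i.
have Is0 : I i0 s0 := Ix i0.
have Isi : I i si := Ix i.
have J0 : J (f i0 s0) := fun0 _ Is0.
have Jnear : \forall z \near f i0 s0, J z.
  exact: (open_nbhs_nbhs (conj Jo J0)).
have dfi : is_derive si (1 : R) (f i) (derive1 (f i) si).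
  rewrite derive1E; apply: derivableP.
  exact: (nbhs_singleton (analytic1_derivable (fani _ Isi))).
have [d0 dg] := gD _ Is0.
(* [g (z t)] is the coordinate of index [i0] that compensates for the move [t] of
   the coordinate of index [i]. *)
pose z t := f i0 s0 + f i si - f i (si + t).
have dsi : is_derive (0 : R) (1 : R) (fun t : R => si + t) (1 : R).
  have dc := is_derive_cst si (0 : R) (1 : R).
  by apply: (is_derive_eq (is_deriveD dc (is_derive_id (0 : R) (1 : R)))); rewrite add0r.
have dfi0 : is_derive (0 : R) (1 : R) (fun t : R => f i (si + t)) (derive1 (f i) si).
  have dfi' : is_derive (si + 0) (1 : R) (f i) (derive1 (f i) si) by rewrite addr0.
  by have := @is_derive1_comp _ (f i) (fun t => si + t) 0 _ _ dfi' dsi; rewrite mulr1.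
have dz : is_derive (0 : R) (1 : R) z (- derive1 (f i) si).
  have dc := is_derive_cst (f i0 s0 + f i si) (0 : R) (1 : R).
  by apply: (is_derive_eq (is_deriveB dc dfi0)); rewrite sub0r.
have z0 : z 0 = f i0 s0 by rewrite /z addr0 addrK.
have dgz : is_derive (0 : R) (1 : R) (g \o z)
    ((derive1 (f i0) s0)^-1 * - derive1 (f i) si).
  by apply: is_derive1_comp; rewrite z0.
pose gam t : 'rV[R]_d := \row_j
  if j == i then si + t else if j == i0 then g (z t) else x ord0 j.
pose gam' j : R := if j == i then 1 else
  if j == i0 then (derive1 (f i0) s0)^-1 * - derive1 (f i) si else 0.
have gam0 : gam 0 = x.
  apply/rowP => j; rewrite mxE addr0 z0 gK//.
  by case: eqVneq => [->//|_]; case: eqVneq => [->|].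
have dgam j : is_derive (0 : R) (1 : R) (fun s => gam s ord0 j) (gam' j).
  rewrite /gam' (_ : (fun _ => _) = (fun t => if j == i then si + t
    else if j == i0 then g (z t) else x ord0 j)); last first.
    by apply/funext => t; rewrite mxE.
  by case: eqP => // _; case: eqP => // _; exact: is_derive_cst.
have dF : differentiable F (gam 0) by rewrite gam0; exact: analytic_differentiable.
have dFgam := chain_rule dF dgam.
have Fgam : \forall t \near (0 : R), F (gam t) = 0.
  have Ii : \forall t \near (0 : R), I i (si + t).
    have [dd _] := dsi; have c := differentiable_continuous ((derivable1_diffP _ _).1 dd).
    apply: c; rewrite addr0; exact: (open_nbhs_nbhs (conj (Io i) Isi)).
  have Jz : \forall t \near (0 : R), J (z t).
    have [dd _] := dz; have c := differentiable_continuous ((derivable1_diffP _ _).1 dd).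
    by apply: c; rewrite z0.
  near=> t; have It : I i (si + t) by near: t.
  have [Ig fg] : I i0 (g (z t)) /\ f i0 (g (z t)) = z t by apply: fK; near: t.
  apply/FE.
    move=> j; rewrite mxE; case: eqP => [->//|_]; case: eqP => [->//|_]; exact: Ix.
  have := (FE x Ix).1 Fx0.
  rewrite (bigD1 i)//= (bigD1 i0) 1?eq_sym//= => sx.
  rewrite (bigD1 i)//= (bigD1 i0) 1?eq_sym//= !mxE eqxx (negbTE (_ : i0 != i)) 1?eq_sym//.
  rewrite eqxx fg -[RHS]sx.
  rewrite (eq_bigr (fun j => f j (x ord0 j))); first by rewrite /z /s0 /si; ring.
  by move=> j /andP[ji ji0]; rewrite mxE (negbTE ji) (negbTE ji0).
have [_ D0] : is_derive (0 : R) (1 : R) (F \o gam) (0 : R).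
  apply: near_eq_is_derive (is_derive_cst (0 : R) (0 : R) (1 : R)).
  by apply: filterS Fgam => t /= ->.
have [_] := dFgam; rewrite D0 gam0.
rewrite (bigD1 i)//= (bigD1 i0) 1?eq_sym//= big1 ?addr0; last first.
  by move=> j /andP[ji ji0]; rewrite /gam' (negbTE ji) (negbTE ji0) mul0r.
rewrite /gam' eqxx (negbTE (_ : i0 != i)) 1?eq_sym// eqxx mul1r.
move=> /esym/eqP; rewrite addr_eq0 => /eqP ->.
by field.
Unshelve. all: by end_near. Qed.

(** The factors [alpha1 i0 = 1 / (f i0)'] and [alpha2 j = (f j)'] for [j != i0] carry
    all the information; the others are 1 and [G] is a partial derivative of [F]. *)
Lemma degenerate_factorizes Omega F p (i0 : 'I_d) :
  analytic_on F Omega -> locally_degenerate Omega F p ->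
  factorizes_near Omega F p.
Proof.
move=> Fan [I [J [f [II boxO [[Jo _] J0] fiso FE]]]].
have Io i : open (I i) by have [[]] := II i.
have f_an i s : I i s -> analytic1_at (f i) s by have [H _ _] := fiso i; exact: H.
have f0 s : I i0 s -> derive1 (f i0) s != 0.
  by move=> Is; have [g [_ _ gD]] := analytic_iso_inverse Jo (fiso i0); have [] := gD _ Is.
have proj j s : [set x ord0 j | x in box I] s -> I j s.
  by move=> [x Ix <-]; exact: Ix.
exists (box I), (partial i0 F).
exists (fun j s => if j == i0 then 1 / derive1 (f i0) s else 1).
exists (fun j s => if j == i0 then 1 else derive1 (f j) s).
split.
- split=> //; first exact: open_box.
  by move=> i; have [] := II i.
- by move=> x /boxO/Fan; exact: analytic_partial.
- move=> j s /proj Is; case: eqP => [ji|_]; last exact: analytic1_cst.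
  rewrite ji in Is; apply: analytic1_quotient; [exact: analytic1_cst| |exact: f0].
  exact/analytic1_derive1/f_an.
- move=> j s /proj Is; case: eqP => _; first exact: analytic1_cst.
  exact/analytic1_derive1/f_an.
- move=> x [Ix [Ox Fx0]] i.
  have [ii0|ii0] := eqVneq i i0.
    rewrite ii0 mulr1 big1 ?mulr1// => j /negbTE ji.
    by rewrite ji.
  have E := degenerate_parallel (Fan _ Ox) Io Jo fiso FE Ix Fx0 ii0.
  rewrite (bigD1 i0) 1?eq_sym//= eqxx big1; last first.
    by move=> j /andP[_ /negbTE ->].
  by rewrite mulr1 mul1r -E mulfK//; exact: f0.
Qed.

End Forward.

(** * From the factorization to degeneracy *)

Section Converse.
Variables (R : realType) (d : nat).
Implicit Types (F G : 'rV[R]_d -> R) (p x y v : 'rV[R]_d) (Omega : set 'rV[R]_d).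
Implicit Types (beta : 'I_d -> R -> R).

Lemma uniform_pos (P : 'I_d -> R -> Prop) (e0 : R) : 0 < e0 ->
  (forall j e e', e' <= e -> P j e -> P j e') ->
  (forall j, exists2 e, 0 < e & P j e) ->
  exists e, [/\ 0 < e, e <= e0 & forall j, P j e].
Proof.
move=> e00 Pm Pe.
have /choice[e eP] : forall j, exists e : R, 0 < e /\ P j e.
  by move=> j; have [e ? ?] := Pe j; exists e.
exists (\big[Num.min/e0]_j e j); split.
- by apply: lt_bigmin => // j _; have [] := eP j.
- exact: bigmin_le_id.
- by move=> j; have [_] := eP j; apply: Pm; exact: bigmin_le.
Qed.

Lemma norm_rV_lt v (e : R) : 0 < e -> (forall j, `|v ord0 j| < e) -> `|v| < e.
Proof.
move=> e0 ve; rewrite [ltLHS]/Num.Def.normr/= mx_normrE.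
by apply: bigmax_lt => // -[i j] _; rewrite (ord1 i).
Qed.

Lemma coord_lt_norm v (e : R) j : `|v| < e -> `|v ord0 j| < e.
Proof. by move=> ve; apply: le_lt_trans (coord_le_norm _ _) ve. Qed.

(** What remains of a factorization after dividing by [\prod_j alpha1 j (x j)]:
    only the quotients [beta j] of [alpha2 j] by [alpha1 j] matter. *)
Definition parallel_near Omega F p beta (e : R) :=
  [/\ forall x, `|x - p| < e -> Omega x,
      forall j s, `|s - p ord0 j| < e -> analytic1_at (beta j) s,
      forall j, beta j (p ord0 j) != 0 &
      forall x, `|x - p| < e -> F x = 0 ->
        exists lam, forall j, partial j F x = lam * beta j (x ord0 j)].

(** For [d > 1] the regularity of [p] forces every [alpha1 j] to be nonzero at [p],
    since it divides some partial derivative.  For [d = 1] the product over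
    [j != i] is empty, and [beta = 1] works because a gradient has a single component. *)
Lemma factorizes_parallel Omega F p (i0 : 'I_d) : coordinate_regular Omega F p ->
  factorizes_near Omega F p ->
  exists beta e, 0 < e /\ parallel_near Omega F p beta e.
Proof.
move=> [[Op Fp] reg] [U [G [a1 [a2 [[Uo Up UO] Gan a1an a2an fac]]]]].
have /nearP_norm[e0 e00 eU] : \forall x \near p, U x.
  exact: (open_nbhs_nbhs (conj Uo Up)).
have proj j s : `|s - p ord0 j| < e0 -> [set x ord0 j | x in U] s.
  move=> se; exists (p + (s - p ord0 j) *: delta_mx ord0 j).
    apply: eU; rewrite addrC addKr normrZ; apply: le_lt_trans se.
    by rewrite ler_piMr// norm_delta.
  by rewrite !mxE !eqxx mulr1 subrKC.
have [d1|d1] := leqP d 1.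
  exists (fun _ _ => 1), e0; split=> //; split.
  - by move=> x /eU/UO.
  - by move=> j s _; exact: analytic1_cst.
  - by move=> j; exact: oner_neq0.
  - move=> x xe Fx; exists (partial i0 F x) => j; rewrite mulr1; congr (partial _ F x).
    have lt1 (k : 'I_d) : k = 0%N :> nat.
      by apply/eqP; rewrite -leqn0 -ltnS (leq_trans (ltn_ord k)).
    by apply/val_inj; rewrite /= !lt1.
have zp i := fac p (conj Up (conj Op Fp)) i.
have other j : exists i : 'I_d, j != i.
  have d0 : (0 < d)%N by apply: leq_trans d1.
  have [->|j0] := eqVneq j (Ordinal d0); last by exists (Ordinal d0).
  by exists (Ordinal d1).
have a1p j : a1 j (p ord0 j) != 0.
  have [i ji] := other j; have := reg i; rewrite zp mulf_eq0 negb_or => /andP[_].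
  by rewrite (bigD1 j)//= mulf_eq0 negb_or => /andP[].
have a2p j : a2 j (p ord0 j) != 0.
  by have := reg j; rewrite zp !mulf_eq0 !negb_or => /andP[/andP[]].
pose P j (e : R) := forall s, `|s - p ord0 j| < e -> a1 j s != 0.
have [e [e_gt0 ee0 eP]] : exists e, [/\ 0 < e, e <= e0 & forall j, P j e].
  apply: uniform_pos => // [j e e' ee' Pe s se|j]; first by apply: Pe; exact: lt_le_trans ee'.
  have c : {for p ord0 j, continuous (a1 j)}.
    by apply/analytic1_continuous/a1an/proj; rewrite subrr normr0.
  apply/(nearP_dist (p ord0 j) (fun s => is_true (a1 j s != 0))).
  exact: (cvgr_neq0 _ c (a1p j)).
exists (fun j s => a2 j s / a1 j s), e; split => //.
have lee0 (r : R) : r < e -> r < e0 by move=> re; exact: lt_le_trans ee0.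
split.
- by move=> x /lee0/eU/UO.
- move=> j s se; apply: analytic1_quotient; last exact: eP.
    by apply/a2an/proj/lee0.
  by apply/a1an/proj/lee0.
- by move=> j; rewrite mulf_neq0// invr_eq0.
- move=> x xe Fx; exists (G x * \prod_j a1 j (x ord0 j)) => j.
  have Ux := eU _ (lee0 _ xe).
  rewrite (fac x (conj Ux (conj (UO _ Ux) Fx)) j) (bigD1 j (P := predT))//=.
  have a1x : a1 j (x ord0 j) != 0.
    by apply: eP; have := coord_lt_norm j xe; rewrite !mxE.
  by field.
Qed.

(** In the coordinates given by primitives of the [beta j], all partial
    derivatives of [F] at a zero are equal to the factor [lam]. *)
Lemma parallel_degenerate Omega F p beta (e : R) (i0 : 'I_d) :
  analytic_on F Omega -> F p = 0 -> partial i0 F p != 0 ->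
  0 < e -> parallel_near Omega F p beta e -> locally_degenerate Omega F p.
Proof.
move=> Fan Fp Fi0 e_gt0 [eO ban bp par].
pose kap := partial i0 F p / beta i0 (p ord0 i0).
have kap0 : kap != 0 by rewrite mulf_neq0// invr_eq0.
have pO : Omega p by apply: eO; rewrite subrr normr0.
have kap2 : 0 < kap ^+ 2 by rewrite exprn_even_gt0.
(* After multiplication by [kap], the derivative of [F] in the new coordinate
   of index [i0] is positive at [p], whatever the sign of the original one. *)
have : \forall x \near p, kap ^+ 2 / 2 < kap * (partial i0 F x / beta i0 (x ord0 i0)).
  have cF : {for p, continuous (partial i0 F)}.
    exact/differentiable_continuous/analytic_differentiable/analytic_partial/Fan.
  have cb : {for p, continuous (fun x : 'rV[R]_d => beta i0 (x ord0 i0))}.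
    apply: continuous_comp.
      exact/differentiable_continuous/differentiable_coord.
    by apply/analytic1_continuous/ban; rewrite subrr normr0.
  have c : (fun x : 'rV[R]_d => kap * (partial i0 F x / beta i0 (x ord0 i0))) @ nbhs p -->
     kap * (partial i0 F p / beta i0 (p ord0 i0)).
    exact: (cvgM (cvg_cst kap) (cvgM cF (cvgV (bp i0) cb))).
  have lt : kap ^+ 2 / 2 < kap * (partial i0 F p / beta i0 (p ord0 i0)).
    by rewrite -/kap -expr2; lra.
  exact: (cvgr_gt _ c _ lt).
move=> /nearP_norm[e1 e10 e1P].
pose e2 := Num.min e e1.
have e20 : 0 < e2 by rewrite lt_min e_gt0.
have lte (r : R) : r < e2 -> r < e by rewrite lt_min => /andP[].
have lte1 (r : R) : r < e2 -> r < e1 by rewrite lt_min => /andP[].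
have /choice[q qP] : forall j, exists q : (R -> R) * (R -> R) * (R * R),
    [/\ 0 < q.2.1 <= e2, 0 < q.2.2, q.1.1 (p ord0 j) = 0 &
    [/\ forall s, `|s - p ord0 j| < q.2.1 -> [/\ analytic1_at q.1.1 s,
          is_derive s (1 : R) q.1.1 (beta j s) & beta j s != 0],
       forall y : R, `|y| < q.2.2 -> [/\ `|q.1.2 y - p ord0 j| < q.2.1,
          q.1.1 (q.1.2 y) = y & analytic1_at q.1.2 y] &
       forall s, `|s - p ord0 j| < q.2.1 -> `|q.1.1 s| < q.2.2 -> q.1.2 (q.1.1 s) = s]].
  move=> j; have [|f [g [r [eta H]]]] := @analytic1_coordinate R (beta j) (p ord0 j) e2 e20 _ (bp j).
    by move=> s /lte; exact: ban.
  by exists (f, g, (r, eta)).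
pose f j := (q j).1.1; pose g j := (q j).1.2; pose rad j := (q j).2.1.
have [eps [eps0 _ epsP]] : exists eps : R, [/\ 0 < eps, eps <= 1 & forall j, eps <= (q j).2.2].
  apply: uniform_pos => // [j r r' rr' H|j]; first exact: le_trans H.
  by have [_ ? _ _] := qP j; exists (q j).2.2.
have rad0 j : 0 < rad j by have [/andP[]] := qP j.
have rad2 j : rad j <= e2 by have [/andP[]] := qP j.
have f0 j : f j (p ord0 j) = 0 by have [] := qP j.
have fP j s : `|s - p ord0 j| < rad j -> [/\ analytic1_at (f j) s,
    is_derive s (1 : R) (f j) (beta j s) & beta j s != 0].
  by have [_ _ _ [H _ _]] := qP j; exact: H.
have gP j (y : R) : `|y| < eps -> [/\ `|g j y - p ord0 j| < rad j, f j (g j y) = y &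
    analytic1_at (g j) y].
  by have [_ _ _ [_ H _]] := qP j; move=> ye; apply: H; exact: lt_le_trans (epsP j).
have gK j s : `|s - p ord0 j| < rad j -> `|f j s| < eps -> g j (f j s) = s.
  have [_ _ _ [_ _ H]] := qP j; move=> se fse; apply: H => //.
  exact: lt_le_trans (epsP j).
have gD j (y : R) : `|y| < eps -> is_derive y (1 : R) (g j) (beta j (g j y))^-1.
  move=> ye; have [gye fgy gan] := gP j y ye.
  have [_ fd _] := fP _ _ gye.
  apply: (proj2 (is_derive_local_inverse fgy _ _ fd)); last exact: nbhs_singleton (analytic1_derivable gan).
  apply/nearP_dist; exists (eps - `|y|); first by rewrite subr_gt0.
  move=> z zy; have [] // := gP j z.
  by have := ler_distD y z 0; rewrite !subr0; lra.
clearbody f g rad; clear epsP q qP.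
pose gg y : 'rV[R]_d := \row_j g j (y ord0 j).
have ggp y : `|y| < eps -> `|gg y - p| < e2.
  move=> ye; apply: norm_rV_lt => // j; rewrite !mxE.
  have [H _ _] := gP j _ (coord_lt_norm j ye).
  exact: lt_le_trans H (rad2 j).
pose Psi y := kap * F (gg y).
have dPsi y v : `|y| < eps -> is_derive (0 : R) (1 : R) (fun t : R => Psi (y + t *: v))
    (kap * \sum_j v ord0 j * ((beta j (g j (y ord0 j)))^-1 * partial j F (gg y))).
  move=> ye; pose gam t := gg (y + t *: v).
  have dg j : is_derive (0 : R) (1 : R) (fun s => gam s ord0 j)
      ((beta j (g j (y ord0 j)))^-1 * v ord0 j).
    have dl : is_derive (0 : R) (1 : R) (fun t : R => y ord0 j + t * v ord0 j) (v ord0 j).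
      have dc := is_derive_cst (y ord0 j) (0 : R) (1 : R).
      have di := is_deriveM (is_derive_id (0 : R) (1 : R)) (is_derive_cst (v ord0 j) (0 : R) (1 : R)).
      apply: (is_derive_eq (is_deriveD dc di)).
      by rewrite /GRing.scale /= !mulr0 !add0r mulr1.
    have dgj : is_derive (y ord0 j + 0 * v ord0 j) (1 : R) (g j) (beta j (g j (y ord0 j)))^-1.
      by rewrite mul0r addr0; apply/gD/coord_lt_norm.
    have -> : (fun s => gam s ord0 j) = g j \o (fun t => y ord0 j + t * v ord0 j).
      by apply/funext => t; rewrite /= !mxE.
    exact: (@is_derive1_comp _ (g j) (fun t => y ord0 j + t * v ord0 j) 0 _ _ dgj dl).
  have dF : differentiable F (gam 0).
    apply/analytic_differentiable/Fan/eO/lte; rewrite /gam scale0r addr0; exact: ggp.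
  have dFg := chain_rule dF dg.
  have gam0 : gam 0 = gg y by rewrite /gam scale0r addr0.
  apply: (is_derive_eq (is_deriveZ kap dFg)); rewrite gam0; congr (_ * _).
  by apply: eq_bigr => j _; ring.
have gg0 : gg 0 = p.
  apply/rowP => j; rewrite !mxE -(f0 j) gK ?f0 ?normr0//.
  by rewrite subrr normr0.
have inO x : `|x - p| < e2 -> analytic_at F x by move=> /lte/eO/Fan.
have Psi_cont y : `|y| < eps -> {for y, continuous Psi}.
  move=> ye; have ggc : {for y, continuous gg}.
    apply/(@cvgrPdist_lt _ 'rV[R]_d _ (nbhs y) (nbhs_filter y)) => k k0.
    have H j : \forall z \near y, `|gg y ord0 j - gg z ord0 j| < k.
      have [_ _ gan] := gP j _ (coord_lt_norm j ye).
      have c : {for y, continuous (fun z : 'rV[R]_d => g j (z ord0 j))}.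
        apply: continuous_comp; last exact: analytic1_continuous gan.
        exact/differentiable_continuous/differentiable_coord.
      have /cvgrPdist_lt/(_ k k0) := c.
      by apply: filterS => z /=; rewrite !mxE.
    apply: filterS (@filter_forall _ _ (fun j z => `|gg y ord0 j - gg z ord0 j| < k) (nbhs y) _ H).
    by move=> z zj; apply: norm_rV_lt => // j; rewrite !mxE; have := zj j; rewrite !mxE.
  have Fc : {for gg y, continuous F}.
    exact/differentiable_continuous/analytic_differentiable/inO/ggp.
  have Fgc : {for y, continuous (F \o gg)} by exact: continuous_comp.
  exact: (cvgM (cvg_cst kap) Fgc).
have [|||||eta eta0 etaP] := @flat_zero_set R d Psi i0 eps (kap ^+ 2 / 2) eps0.
- by rewrite divr_gt0.
- by rewrite /Psi gg0 Fp mulr0.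
- exact: Psi_cont.
- move=> y ye; eexists; last exact: dPsi.
  apply: ltW; rewrite (bigD1 i0)//= big1 ?addr0; last first.
    by move=> j /negbTE ji; rewrite mxE ji andbF mul0r.
  rewrite mxE !eqxx mul1r mulrC [_^-1 * _]mulrC mulrC.
  by have := e1P _ (lte1 _ (ggp _ ye)); rewrite mxE.
- move=> y v ye /eqP; rewrite mulf_eq0 (negbTE kap0) /= => /eqP Fy sv.
  have [lam lamP] := par _ (lte _ (ggp _ ye)) Fy.
  apply: (is_derive_eq (dPsi y v ye)).
  rewrite (eq_bigr (fun j => v ord0 j * lam)).
    by rewrite -mulr_suml sv mul0r mulr0.
  move=> j _; rewrite lamP mxE.
  have [gye _ _] := gP j _ (coord_lt_norm j ye).
  by have [_ _ b0] := fP _ _ gye; field.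
pose r := Num.min eta eps.
have r0 : 0 < r by rewrite lt_min eta0.
have r_eta (s : R) : s < r -> s < eta by rewrite lt_min => /andP[].
have r_eps (s : R) : s < r -> s < eps by rewrite lt_min => /andP[].
pose J : set R := [set` `]- r, r[].
have JE s : J s <-> `|s| < r by rewrite /J /= in_itv /= ltr_norml.
pose I j : set R := [set s | `|s - p ord0 j| < rad j /\ J (f j s)].
have gI j s : J s -> I j (g j s) /\ f j (g j s) = s.
  by move=> Js; have [H fg _] := gP j s (r_eps _ ((JE _).1 Js)); split=> //; split=> //; rewrite fg.
have gfI j s : I j s -> g j (f j s) = s.
  by move=> [se /JE/r_eps]; exact: gK.
have Jopen : open J by exact: interval_open.
exists I, J, f; split.
- move=> j; split; last first.
    by split; [rewrite subrr normr0|rewrite f0; apply/JE; rewrite normr0].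
  split.
    rewrite openE => s [se Js]; apply: filterI.
      apply/nearP_dist; exists (rad j - `|s - p ord0 j|); first by rewrite subr_gt0.
      by move=> u us; have := ler_distD s u (p ord0 j); lra.
    have [fan _ _] := fP _ _ se.
    have fc := analytic1_continuous fan.
    exact: (fc J (open_nbhs_nbhs (conj Jopen Js))).
  have -> : I j = g j @` J.
    apply/seteqP; split => [s Is|_ [s Js <-]]; last by have [] := gI j s Js.
    by exists (f j s); [case: Is|exact: gfI].
  apply/connected_intervalP/connected_continuous_connected.
    by apply/connected_intervalP; exact: interval_is_interval.
  apply: continuous_in_subspaceT => s; rewrite inE => Js.
  by have [_ _ /analytic1_continuous] := gP j s (r_eps _ ((JE _).1 Js)).
- move=> x xI; apply/eO/lte/norm_rV_lt => // j; rewrite !mxE.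
  by have [H _] := xI j; exact: lt_le_trans H (rad2 j).
- split; last by apply/JE; rewrite normr0.
  by split => //; exact: interval_is_interval.
- move=> j; split.
  + by move=> s [se _]; have [] := fP _ _ se.
  + split.
    * by move=> s [].
    * move=> s u; rewrite !inE => Is Iu fsu.
      by rewrite -(gfI _ _ Is) -(gfI _ _ Iu) fsu.
    * by move=> s /(gI j)[Ig fg]; exists (g j s).
  + exists (g j); split; first exact: gfI.
    by move=> s Js; have [_ _] := gP j s (r_eps _ ((JE _).1 Js)).
- move=> x xI; pose y : 'rV[R]_d := \row_j f j (x ord0 j).
  have yr : `|y| < r by apply: norm_rV_lt => // j; rewrite mxE; apply/JE; have [] := xI j.
  have ggy : gg y = x by apply/rowP => j; rewrite !mxE gfI.
  have := etaP y (r_eta _ yr); rewrite /Psi ggy.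
  under eq_bigr do rewrite mxE.
  move=> H; rewrite -H; split => [->|/eqP]; first by rewrite mulr0.
  by rewrite mulf_eq0 (negbTE kap0) => /eqP.
Qed.

End Converse.

Theorem theorem2p3 (R : realType) (d : nat) (Omega : set 'rV[R]_d)
    (F : 'rV[R]_d -> R) (p : 'rV[R]_d) :
  open Omega ->
  analytic_on F Omega ->
  locally_irreducible Omega F ->
  coordinate_regular Omega F p ->
  (locally_degenerate Omega F p -> factorizes_near Omega F p) /\
  (factorizes_near Omega F p -> locally_degenerate Omega F p).
Proof.
move=> _ Fan Firr reg; have [[Op Fp] reg'] := reg.
have [d0|d0] := posnP d.
  (* Without coordinates [p] is the only point, so [F] vanishes as a germ at [p],
     which irreducibility excludes. *)
  have [nF _ _] := Firr p (conj Op Fp).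
  exfalso; apply: nF; near=> x; rewrite (_ : x = p)//.
  by apply/rowP => -[j jd]; exfalso; rewrite d0 in jd.
pose i0 : 'I_d := Ordinal d0; split; first exact: degenerate_factorizes.
move=> /(factorizes_parallel i0 reg)[beta [e [e0 par]]].
exact: parallel_degenerate (reg' i0) e0 par.
Unshelve. all: by end_near. Qed.
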